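(* For every $n\ge2$, the biEulerian polynomial $B_n(x)$ has only real roots. Consequently the $h$-vector of the bipermutahedral fan $\Sigma_{n,n}$ is log-concave and unimodal.
   Context: A bipermutation of $[n]$ is a sequence $\mathsf{B}=b_1|\cdots|b_{2n-1}$ of elements of $[n]$ in which one element $k=k(\mathsf{B})$ appears exactly once and every other element appears exactly twice. Write first occurrences of each $i\ne k$ as $i$ and second occurrences as $\overline i$; the single occurrence of $k$ is regarded as $k$ when compared with an unbarred letter and as $\overline k$ when compared with a barred letter. Two consecutive letters $i|j$ form a descent if (a) both are unbarred and $i>j$; or (b) both are barred and $i<j$ (comparing underlying numbers); or (c) $i$ is an unbarred element of $[n]\setminus\{k\}$, $j$ is a barred letter $\overline{j'}$ with $j'\ne k$, and $i>k$; or (d) $i$ is barred with $i\ne\overline k$, $j$ is an unbarred element of $[n]\setminus\{k\}$, and $j<k$. The biEulerian polynomial is $B_n(x)=\sum_{i=0}^{2n-2}b(n,i)x^i$, with $b(n,i)$ the number of bipermutations of $[n]$ with exactly $i$ descents. Let $N_n=\mathbb{R}^n/\mathbb{R}(1,\dots,1)$; for $S\subseteq[n]$ let $\mathsf{e}_S,\mathsf{f}_S$ be the images in the first, second factor of $N_n\times N_n$ of the indicator vector of $S$. The bipermutahedral fan $\Sigma_{n,n}$ is the complete simplicial fan in $N_n\times N_n$ (of dimension $D=2n-2$) whose maximal cones are $\mathrm{cone}\{\mathsf{e}_{\{b_1,\dots,b_m\}}+\mathsf{f}_{\{b_{m+1},\dots,b_{2n-1}\}}:1\le m\le 2n-2\}$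 for the bipermutations, with all their faces. Its $h$-vector $(h_0,\dots,h_D)$ is defined by $\sum_i h_i(x+1)^{D-i}=\sum_i f_ix^{D-i}$, $f_i$ the number of $i$-dimensional cones. A sequence $(a_i)$ is log-concave if $a_i^2\ge a_{i-1}a_{i+1}$ for all $i$, and unimodal if it weakly increases and then weakly decreases. *)

(* Defs.v *)
From HB Require Import structures.
From mathcomp Require Import all_boot all_order all_algebra.
From mathcomp Require Import generic_quotient ring_quotient finmap.
From mathcomp Require Import boolp classical_sets functions cardinality reals.
From mathcomp Require Import complex.

Set Implicit Arguments.
Unset Strict Implicit.
Unset Printing Implicit Defensive.

Import Order.TTheory GRing.Theory Num.Theory.

Local Open Scope ring_scope.
Local Open Scope quotient_scope.

(* Quotient of a finite-dimensional vector space by a subspace: the quotient  *)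
(* group of ring_quotient, with the induced vector space structure.           *)

Section VectQuotient.
Variables (K : fieldType) (vT : vectType K) (U : {vspace vT}).

Definition vquot : Type := Quotient.quot (pred_of_vspace U).
HB.instance Definition _ := GRing.Zmodule.on vquot.

Definition vquot_pi (v : vT) : vquot := \pi_(Quotient.quot (pred_of_vspace U)) v.
Definition vquot_repr (x : vquot) : vT :=
  repr (x : Quotient.quot (pred_of_vspace U)).

Lemma vquot_reprK x : vquot_pi (vquot_repr x) = x.
Proof. exact: reprK. Qed.

Lemma vquot_piP v w : (vquot_pi v = vquot_pi w) <-> (v - w \in U).
Proof.
by split=> [/eqP|] h; [|apply/eqP]; move: h; rewrite (Quotient.idealrBE (pred_of_vspace U)).
Qed.

Lemma vquot_piB : {morph vquot_pi : v w / v - w}.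
Proof. by move=> v w; rewrite /vquot_pi raddfB. Qed.

Lemma vquot_piD : {morph vquot_pi : v w / v + w}.
Proof. by move=> v w; rewrite /vquot_pi raddfD. Qed.

Definition vquot_scale (a : K) (x : vquot) : vquot := vquot_pi (a *: vquot_repr x).

Lemma vquot_piZ a v : vquot_pi (a *: v) = vquot_scale a (vquot_pi v).
Proof.
apply/vquot_piP; rewrite -scalerBr memvZ//.
by apply/vquot_piP; rewrite vquot_reprK.
Qed.

Fact vquot_scaleA a b x :
  vquot_scale a (vquot_scale b x) = vquot_scale (a * b) x.
Proof.
by rewrite -(vquot_reprK x) -!vquot_piZ scalerA.
Qed.

Fact vquot_scale1 : left_id 1 vquot_scale.
Proof. by move=> x; rewrite -(vquot_reprK x) -vquot_piZ scale1r. Qed.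

Fact vquot_scaleDr : right_distributive vquot_scale +%R.
Proof.
move=> a x y; rewrite -(vquot_reprK x) -(vquot_reprK y).
by rewrite -vquot_piD -!vquot_piZ -vquot_piD scalerDr.
Qed.

Fact vquot_scaleDl x : {morph vquot_scale^~ x : a b / a + b}.
Proof.
by move=> a b; rewrite -(vquot_reprK x) -!vquot_piZ -vquot_piD scalerDl.
Qed.

HB.instance Definition _ := GRing.Zmodule_isLmodule.Build K vquot
  vquot_scaleA vquot_scale1 vquot_scaleDr vquot_scaleDl.

Fact vquot_pi_linear : linear vquot_pi.
Proof. by move=> a v w; rewrite vquot_piD vquot_piZ. Qed.

HB.instance Definition _ := GRing.isLinear.Build K vT vquot _ vquot_pi
  vquot_pi_linear.

Fact vquot_vect_iso : Vector.axiom (\dim U^C) vquot.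
Proof.
have dUC : (U^C :&: U = 0)%VS by rewrite capvC capv_compl.
have dec v : daddv_pi U^C U v + daddv_pi U U^C v = v.
  by apply: daddv_pi_add; rewrite // addvC addv_complf memvf.
pose g v := \row_(i < \dim U^C) coord (vbasis U^C) i (daddv_pi U^C U v).
have gpi x : g (vquot_repr (vquot_pi x)) = g x.
  apply/rowP=> i; rewrite !mxE; congr (coord _ _ _).
  apply/eqP; rewrite -subr_eq0 -linearB; set d := _ - x.
  have dU : d \in U by apply/vquot_piP; rewrite vquot_reprK.
  have := dec d; rewrite (daddv_pi_id (U := U)) ?capv_compl//.
  by rewrite -[RHS]add0r => /addIr h; apply/eqP.
exists (fun x => g (vquot_repr x)).
  move=> a x y; rewrite -{1}(vquot_reprK x) -{1}(vquot_reprK y).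
  by rewrite -linearP gpi; apply/rowP=> i; rewrite !mxE !linearP.
exists (fun r : 'rV_(\dim U^C) => vquot_pi (\sum_i r 0 i *: (vbasis U^C)`_i)).
  move=> x; rewrite -[RHS]vquot_reprK; set v := vquot_repr x.
  have -> : \sum_i g v 0 i *: (vbasis U^C)`_i = daddv_pi U^C U v.
    rewrite [RHS](coord_vbasis (memv_pi _ _ _)).
    by apply: eq_bigr => i _; rewrite mxE.
  apply/vquot_piP; rewrite -[X in _ - X]dec opprD addrA subrr add0r rpredN.
  exact: memv_pi.
move=> r; rewrite gpi; apply/rowP=> i; rewrite mxE daddv_pi_id//.
  by rewrite coord_sum_free ?(basis_free (vbasisP _)).
by apply: rpred_sum => j _; rewrite rpredZ ?vbasis_mem ?mem_nth ?size_tuple.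
Qed.

HB.instance Definition _ := Lmodule_hasFinDim.Build K vquot vquot_vect_iso.

End VectQuotient.

(* [n] is represented by 'I_n, i.e. shifted to {0, ..., n - 1}; only the      *)
(* order of the letters matters.                                              *)

Section Bipermutations.
Variable n : nat.
Implicit Types (k : 'I_n) (B : seq 'I_n).

Definition word := (2 * n - 1).-tuple 'I_n.

Definition is_bipermutation_at k B : bool :=
  (count_mem k B == 1)%N && [forall i, (i != k) ==> (count_mem i B == 2)%N].

Definition bipermutation (B : word) : bool :=
  [exists k, is_bipermutation_at k B].

Definition barred k B (p : nat) : bool := nth k B p \in take p B.

(* Positions p and p.+1 are compared. When one of the two letters is k it     *)
(* takes the bar status of the other one, so that the first two clauses apply.*)
Definition descent k B (p : nat) : bool :=
  let i := nth k B p in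
  let j := nth k B p.+1 in
  let bar_i := if i == k then barred k B p.+1 else barred k B p in
  let bar_j := if j == k then barred k B p else barred k B p.+1 in
  [|| [&& ~~ bar_i, ~~ bar_j & (j < i)%N],
      [&& bar_i, bar_j & (i < j)%N],
      [&& i != k, j != k, ~~ bar_i, bar_j & (k < i)%N]
    | [&& i != k, j != k, bar_i, ~~ bar_j & (j < k)%N]].

Definition num_descents k B : nat := count (descent k B) (iota 0 (size B).-1).

(* The letter k is determined by B, so the existential introduces no choice.  *)
Definition biEulerian_number (i : nat) : nat :=
  #|[set B : word |
      [exists k, is_bipermutation_at k B && (num_descents k B == i)]]|.

Definition biEulerian : {poly int} :=
  \sum_(i < 2 * n - 1) (biEulerian_number i)%:Z *: 'X^i.

End Bipermutations.

Definition real_rooted (R : realType) (p : {poly int}) : Prop :=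
  forall z : R[i], root (map_poly intr p) z -> z \is Num.real.

Section Cones.
Variables (R : realType) (V : vectType R).
Implicit Types (C F : set V) (X : seq V).

Definition cone X : set V :=
  [set x | exists c : 'I_(size X) -> R,
     (forall i, 0 <= c i) /\ x = \sum_i c i *: X`_i]%classic.

Definition face F C : Prop :=
  exists u : 'Hom(V, R^o),
    (forall x, C x -> 0 <= u x) /\ F = [set x | C x /\ u x = 0]%classic.

Definition linear_span C (U : {vspace V}) : Prop :=
  (forall x, C x -> x \in U) /\
  (forall W : {vspace V}, (forall x, C x -> x \in W) -> (U <= W)%VS).

Definition cone_dim C (d : nat) : Prop :=
  exists U : {vspace V}, linear_span C U /\ \dim U = d.

End Cones.

Section BipermutahedralFan.
Variables (R : realType) (n : nat).

Definition Nspace : Type := vquot <[const_mx 1 : 'rV[R]_n]>%VS.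
HB.instance Definition _ := Vector.on Nspace.

Definition NNspace : Type := (Nspace * Nspace)%type.
HB.instance Definition _ := Vector.on NNspace.

Definition indicator (S : {set 'I_n}) : 'rV[R]_n := \row_i (i \in S)%:R.

Definition e_ (S : {set 'I_n}) : NNspace := (vquot_pi _ (indicator S), 0).
Definition f_ (S : {set 'I_n}) : NNspace := (0, vquot_pi _ (indicator S)).

Definition rays (B : word n) : seq NNspace :=
  [seq e_ [set i in take m B] + f_ [set i in drop m B]
     | m <- iota 1 (2 * n - 2)].

Definition bipermutahedral_fan : set (set NNspace) :=
  [set F | exists2 B : word n, bipermutation B & face F (cone (rays B))]%classic.

(* The set of cones is finite, so fset_set does not take its default value.   *)
Definition fan_fvector (i : nat) : nat :=
  #|` fset_set [set C | bipermutahedral_fan C /\ cone_dim C i]%classic|%fset.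

End BipermutahedralFan.

Definition hvector (D : nat) (f : nat -> nat) : seq int :=
  mkseq (fun i => ((\sum_(j < D.+1) (f j)%:Z *: 'X^(D - j))
                     \Po ('X - 1 : {poly int}))`_(D - i)) D.+1.

(* hvector is the unique solution of the defining identity of the h-vector.   *)
Lemma hvectorP (D : nat) (f : nat -> nat) (h : seq int) : size h = D.+1 ->
  h = hvector D f <->
  \sum_(i < D.+1) h`_i *: ('X + 1 : {poly int}) ^+ (D - i) =
  \sum_(i < D.+1) (f i)%:Z *: 'X^(D - i).
Proof.
move=> sz.
pose F : {poly int} := \sum_(i < D.+1) (f i)%:Z *: 'X^(D - i).
rewrite -/F; pose P : {poly int} := \sum_(i < D.+1) h`_i *: 'X^(D - i).
have PX : P \Po ('X + 1) = \sum_(i < D.+1) h`_i *: ('X + 1) ^+ (D - i).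
  by rewrite linear_sum; apply: eq_bigr => i _ /=; rewrite linearZ/= comp_Xn_poly.
have Pc (Q : {poly int}) (g : nat -> int) :
    Q = \sum_(i < D.+1) g i *: 'X^(D - i) -> forall i, (i <= D)%N -> Q`_(D - i) = g i.
  move=> -> i iD; rewrite coef_sum (bigD1 (inord i))//= inordK//.
  rewrite coefZ coefXn eqxx mulr1 big1 ?addr0// => j ji.
  rewrite coefZ coefXn; case: eqP => [e|]; last by rewrite mulr0.
  case/eqP: ji; apply: val_inj; rewrite /= inordK//.
  by rewrite -(subKn iD) e subKn// -ltnS.
rewrite -PX; split=> [hE|PF].
  have -> : P = F \Po ('X - 1).
    have szF : (size (F \Po ('X - 1 : {poly int})) <= D.+1)%N.
      rewrite size_comp_poly2; last by rewrite -polyC1 size_XsubC.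
      apply: (leq_trans (size_sum _ _ _)); apply/bigmax_leqP => i _.
      apply: (leq_trans (size_scale_leq _ _)).
      by rewrite size_polyXn ltnS leq_subr.
    have F1 : F \Po ('X - 1) =
        \sum_(i < D.+1) (F \Po ('X - 1))`_(D - i) *: 'X^(D - i).
      rewrite -[LHS](take_poly_id szF) /take_poly poly_def.
      by rewrite (reindex_inj rev_ord_inj); apply: eq_bigr => i _; rewrite /= subSS.
    rewrite [RHS]F1; apply: eq_bigr => i _; congr (_ *: _).
    by rewrite hE nth_mkseq.
  by rewrite -comp_polyA comp_polyB comp_polyX -polyC1 comp_polyC addrK comp_polyXr.
apply: (@eq_from_nth _ 0); first by rewrite size_mkseq.
move=> i; rewrite sz ltnS => iD; rewrite nth_mkseq// -/F -PF -comp_polyA.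
rewrite comp_polyD comp_polyX -polyC1 comp_polyC subrK comp_polyXr.
by rewrite (Pc P (nth 0 h)).
Qed.

Definition bipermutahedral_hvector (R : realType) (n : nat) : seq int :=
  hvector (2 * n - 2) (fan_fvector R n).

Definition log_concave (s : seq int) : Prop :=
  forall i, (0 < i)%N -> (i.+1 < size s)%N ->
    s`_i.-1 * s`_i.+1 <= s`_i ^+ 2.

Definition unimodal (s : seq int) : Prop :=
  exists2 m, (m < size s)%N &
    (forall i, (i < m)%N -> s`_i <= s`_i.+1) /\
    (forall i, (m <= i)%N -> (i.+1 < size s)%N -> s`_i.+1 <= s`_i).

(* Main.v *)
(* Both B_n and the h-vector are computed from configurations of n intervals
   [a_i, b_i] with endpoints in {0, ..., m}, all of which are endpoints of some
   interval, and with an interval of length zero.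

   A point of N_n x N_n is, up to translation, a family of n real intervals of
   minimal length zero: a bipermutation B and positions X_0 <= X_1 <= ... give
   the point (-X(first position of i), X(last position of i))_i. Merging
   positions with equal X turns it into a configuration and a point of its cone. Hence the
   m-dimensional cones of the fan are in bijection with the configurations.

   Sorting the endpoints of a configuration, and breaking ties by a total order
   adapted to the largest k with a_k = b_k, reads off a unique bipermutation
   together with a set of m cuts containing its descents. Therefore
   f_m = sum_d b(n, d) binom(D - d, D - m), that is h_d = b(n, d). Since all
   configurations with endpoints in {0, ..., K - 1}, without the condition on
   the endpoints, number binom(K + 1, 2)^n - binom(K, 2)^n, we also get
     B_n(x) / (1 - x)^(2n + 1) = sum_K binom(K + 2, 2)^n x^K.

   Multiplying the K-th term by K + 1 or K + 2 acts on the numerator by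
   P |-> (1 - x) P' + (e + 1) P, up to powers of x, which preserves
   real-rootedness among polynomials with nonnegative coefficients; B_n is
   obtained from 1 by such steps. Newton's inequalities do the rest. *)
Require Import Defs.
From mathcomp Require Import all_boot all_order all_algebra.
From mathcomp Require Import reals.
From mathcomp Require Import complex.
From mathcomp Require Import zify ring lra.

Set Implicit Arguments.
Unset Strict Implicit.
Unset Printing Implicit Defensive.
Import Order.TTheory GRing.Theory Num.Theory.
Local Open Scope ring_scope.

(** * Real-rooted polynomials with nonnegative coefficients *)

Section NonnegRealRooted.
Variable C : numClosedFieldType.
Implicit Types (P Q W : {poly C}) (z : C).

Definition nonneg_real_rooted P :=
  [/\ P != 0, forall d, 0 <= P`_d & forall z, root P z -> z \is Num.real].

Lemma horner_pos P z : P != 0 -> (forall d, 0 <= P`_d) -> 0 < z -> 0 < P.[z].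
Proof.
move=> P0 Pge zgt; rewrite horner_coef.
have [m szm] : exists m, size P = m.+1 by exists (size P).-1; apply: polySpred.
rewrite szm big_ord_recr /= ltr_wpDl //.
  by apply: sumr_ge0 => i _; apply: mulr_ge0; [exact: Pge|exact/exprn_ge0/ltW].
rewrite mulr_gt0 ?exprn_gt0 // lt_neqAle Pge andbT eq_sym.
by have := lead_coef_eq0 P; rewrite /lead_coef szm /= => ->.
Qed.

Lemma nonneg_real_rooted_le0 P z : nonneg_real_rooted P -> root P z -> z <= 0.
Proof.
move=> [P0 Pge Pr] rz; rewrite real_leNgt ?real0 ?Pr //; apply/negP => zgt.
by have := horner_pos P0 Pge zgt; rewrite (rootP rz) ltxx.
Qed.

Lemma nonneg_real_rooted_MX P : nonneg_real_rooted P <-> nonneg_real_rooted ('X * P).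
Proof.
split=> -[P0 Pge Pr]; split.
- by rewrite mulf_neq0 ?polyX_eq0.
- by move=> d; rewrite coefXM; case: ifP.
- by move=> z; rewrite rootM => /orP[/eqP|/Pr//]; rewrite hornerX => ->; exact: real0.
- by apply: contra_neq P0 => ->; rewrite mulr0.
- by move=> d; have := Pge d.+1; rewrite coefXM.
- by move=> z rz; apply: Pr; rewrite rootM rz orbT.
Qed.

(** Differentiating [P / (1 - x)^e.+1] gives [theta e P / (1 - x)^e.+2]. *)
Definition theta e P : {poly C} := (1 - 'X) * P^`() + e.+1%:R *: P.

Lemma horner_log_deriv (r : seq C) z : z \notin r ->
  (\prod_(s <- r) ('X - s%:P))^`().[z] =
  (\prod_(s <- r) ('X - s%:P)).[z] * \sum_(s <- r) (z - s)^-1.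
Proof.
elim: r => [|s r IH]; first by rewrite !big_nil derivC !hornerE.
rewrite inE negb_or => /andP[zs /IH {}IH].
rewrite !big_cons derivM derivXsubC mul1r hornerD !hornerM IH !hornerXsubC.
have : z - s != 0 by rewrite subr_eq0.
by move: (\sum_(_ <- _) _) (_.[_]) => A B h; field.
Qed.

(* With [P = c \prod (X - s)] the equation [theta e P z = 0] reads
   [\sum (1 - s) / (z - s) = size r - e.+1]; the left-hand side equals
   [A z^* - B] with [A] and [B] real and [A > 0], so that [z] is real. *)
Lemma theta_real e P z : nonneg_real_rooted P -> root (theta e P) z -> z \is Num.real.
Proof.
move=> Prr rz; have [P0 Pge Pr] := Prr.
have [/Pr //|Pz] := boolP (root P z).
have [r Er] := closed_field_poly_normal P; set Q := \prod_(_ <- _) _ in Er.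
have lP : lead_coef P != 0 by rewrite lead_coef_eq0.
have rootr s : s \in r -> root P s.
  by move=> sr; rewrite Er rootZ // root_prod_XsubC.
have zr : z \notin r by apply: contra Pz; apply: rootr.
have Qz : Q.[z] != 0.
  by move: Pz; rewrite Er rootZ.
have zs s : s \in r -> z - s != 0.
  by move=> sr; rewrite subr_eq0; apply: contraNneq zr => ->.
have E : \sum_(s <- r) (1 - s) / (z - s) = (size r)%:R - e.+1%:R.
  have: (1 - z) * \sum_(s <- r) (z - s)^-1 + e.+1%:R = 0.
    move/rootP: rz; rewrite {1}Er.
    have -> : theta e (lead_coef P *: Q) = lead_coef P *: theta e Q.
      by rewrite /theta derivZ -scalerAr scalerDr !scalerA (mulrC (lead_coef P)).
    rewrite hornerZ => /eqP; rewrite mulf_eq0 (negbTE lP) /= => /eqP.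
    have E1 : (1 - 'X : {poly C}).[z] = 1 - z by rewrite !hornerE.
    rewrite hornerD hornerM hornerZ horner_log_deriv // E1 -/Q => h.
    by apply: (mulfI Qz); rewrite mulr0 -[RHS]h; ring.
  move/(canRL (addrK _)); rewrite sub0r mulr_sumr => h.
  rewrite -h -(sum1_size r) natr_sum -big_split /=.
  by apply: eq_big_seq => s /zs; move=> ?; field.
have sre s : s \in r -> s \is Num.real by move=> /rootr/Pr.
pose A := \sum_(s <- r) (1 - s) * `|z - s| ^- 2.
pose B := \sum_(s <- r) (1 - s) * `|z - s| ^- 2 * s.
have S : A * z^* - B = (size r)%:R - e.+1%:R.
  rewrite -E /A /B mulr_suml -sumrB; apply: eq_big_seq => s sr.
  by rewrite invC_norm rmorphB /= (CrealP (sre s sr)); ring.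
have Aterm s : s \in r -> 0 < (1 - s) * `|z - s| ^- 2.
  move=> sr; rewrite mulr_gt0 ?invr_gt0 ?exprn_gt0 ?normr_gt0 ?zs // subr_gt0.
  by rewrite (le_lt_trans (nonneg_real_rooted_le0 Prr (rootr s sr))).
have Bre : B \is Num.real.
  rewrite /B big_seq rpred_sum // => s sr.
  by apply: rpredM; [exact/gtr0_real/Aterm | exact: sre].
have Agt : r != [::] -> 0 < A.
  rewrite /A big_seq; case: r Aterm {Er Q rootr zr Qz zs E sre A B S Bre} => // s r Aterm _.
  rewrite big_cons mem_head ltr_pwDl ?Aterm ?mem_head // sumr_ge0 // => t tr.
  exact/ltW/Aterm.
(* For constant [P] both sums are empty and [S] reads [0 = - e.+1]. *)
have [r0|/Agt{}Agt] := eqVneq r [::].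
  move: S; rewrite /A /B r0 !big_nil /= mul0r subr0 sub0r => /eqP.
  by rewrite eq_sym oppr_eq0 pnatr_eq0.
have zc : z^* = ((size r)%:R - e.+1%:R + B) / A.
  by rewrite -S subrK mulrC mulKf // gt_eqF.
have : z^* \is Num.real.
  by rewrite zc rpredM ?rpredV ?(gtr0_real Agt) // rpredD // rpredB // realn.
by move=> zr'; rewrite -(conjCK z) (CrealP zr').
Qed.

(** The coefficient of degree [d] is [d.+1 * P_d.+1 + (e.+1 - d) * P_d], and the size bound keeps
    the second term nonnegative. *)
Lemma theta_nonneg_real_rooted e P : (size P <= e.+2)%N ->
  nonneg_real_rooted P -> nonneg_real_rooted (theta e P).
Proof.
move=> szP Prr; have [P0 Pge Pr] := Prr; split; last by move=> z; apply: theta_real.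
  (* At 1 only [e.+1 * P(1)], a positive number, survives. *)
  apply/eqP => /(congr1 (fun Q => Q.[1])) /eqP.
  rewrite /theta !hornerE subrr mul0r add0r mulf_eq0 pnatr_eq0 /=.
  by rewrite gt_eqF // horner_pos.
move=> d; rewrite /theta coefD coefZ mulrBl mul1r coefB coefXM !coef_deriv.
have [->|d0] := eqVneq d 0%N.
  by rewrite subr0 addr_ge0 ?mulr_ge0 ?mulrn_wge0.
rewrite prednK ?lt0n // -addrA addr_ge0 ?mulrn_wge0 // -(mulr_natl P`_d) -mulNr -mulrDl.
have [dlt|dge] := ltnP d (size P).
  by rewrite mulr_ge0 // addrC subr_ge0 ler_nat -ltnS (leq_trans dlt).
by rewrite nth_default ?mulr0.
Qed.

(** The coefficient of [x^K] in [P / (1 - x)^e.+1] when [P] has degree at most [e]. As [d <= e], the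
    subtraction is not truncated, and the binomial vanishes for [d > K]. *)
Definition worpitzky e P K : C := \sum_(d < e.+1) P`_d * 'C(K + e - d, e)%:R.

Lemma worpitzkyB e P Q K : worpitzky e (P - Q) K = worpitzky e P K - worpitzky e Q K.
Proof. by rewrite /worpitzky -sumrB; apply: eq_bigr => d _; rewrite coefB mulrBl. Qed.

(** The system is unitriangular: the value at [K = d] involves only coefficients up to [d], the last
    one with factor 1. *)
Lemma worpitzky_inj e P Q : (size P <= e.+1)%N -> (size Q <= e.+1)%N ->
  (forall K, worpitzky e P K = worpitzky e Q K) -> P = Q.
Proof.
move=> szP szQ PQ; apply/eqP; rewrite -subr_eq0; apply/eqP/polyP => d.
have szPQ : (size (P - Q)%R <= e.+1)%N.
  by rewrite (leq_trans (size_polyD _ _)) // geq_max szP size_polyN.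
have := PQ; rewrite coef0; elim/ltn_ind: d => d IH H.
have [dle|dgt] := leqP d e; last by rewrite nth_default ?(leq_trans szPQ).
have := worpitzkyB e P Q d; rewrite PQ subrr /worpitzky.
have dlt : (d < e.+1)%N by [].
rewrite (bigD1 (Ordinal dlt)) //= addKn binn mulr1 big1 ?addr0 // => i.
rewrite -val_eqE /= neq_ltn => /orP[lt|gt]; first by rewrite IH ?mul0r.
by rewrite bin_small ?mulr0 // ltn_subLR ?ltn_add2r // (leq_trans _ (leq_addl _ _)) // -ltnS.
Qed.

(* If [\sum_K F K x^K = W / (1 - x)^e.+1], then
   [\sum_K (K + a) F K x^K = worpitzky_step a e W / (1 - x)^e.+2]. *)
Definition worpitzky_step a e W : {poly C} :=
  (1 - 'X) * ('X * W^`() + a%:R *: W) + e.+1%:R *: ('X * W).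

Lemma coef_worpitzky_step a e W d : (worpitzky_step a e W)`_d =
  (d + a)%:R * W`_d + (if d is d'.+1 then (e.+1%:R - (d' + a)%:R) * W`_d' else 0).
Proof.
have Q d' : ('X * W^`() + a%:R *: W)`_d' = (d' + a)%:R * W`_d'.
  rewrite coefD coefZ coefXM natrD mulrDl; congr (_ + _).
  by case: d' => [|d']; rewrite ?mul0r // coef_deriv mulr_natl.
rewrite /worpitzky_step coefD mulrBl mul1r coefB coefZ !coefXM Q.
by case: d => [|d] /=; rewrite ?Q; ring.
Qed.

Lemma size_worpitzky_step a e W : (size (worpitzky_step a e W) <= (size W).+1)%N.
Proof.
apply/leq_sizeP => -[|d] // h.
by rewrite coef_worpitzky_step !nth_default ?mulr0 ?addr0 // ltnW.
Qed.

Lemma worpitzkyM a e W K : (size W <= e.+1)%N ->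
  worpitzky e.+1 (worpitzky_step a e W) K = (K + a)%:R * worpitzky e W K.
Proof.
move=> szW; rewrite /worpitzky.
under eq_bigr do rewrite coef_worpitzky_step mulrDl.
rewrite big_split /= big_ord_recr [X in _ + X]big_ord_recl /= mul0r add0r.
rewrite [W`_e.+1]nth_default // mulr0 mul0r addr0 -big_split mulr_sumr.
apply: eq_bigr => -[d /= dle] _; rewrite ltnS in dle.
(* With [N = K + e - d], Pascal's rule turns the two contributions of [W_d] into
   [(d + a) C(N, e) + e.+1 C(N, e.+1)], where [e.+1 C(N, e.+1) = (K - d) C(N, e)]. *)
have /(congr1 (fun k => k%:R : C)) := mul_bin_left (K + e - d) e.
have -> : (K + e.+1 - d = (K + e - d).+1)%N by rewrite addnS subSn // (leq_trans dle) ?leq_addl.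
have -> : (K + e.+1 - bump 0 d = K + e - d)%N by rewrite /bump add1n addnS subSS.
rewrite binS.
set N := (K + e - d)%N; rewrite !natrM natrD => h.
have {}h : e.+1%:R * 'C(N, e.+1)%:R = (K%:R - d%:R) * 'C(N, e)%:R :> C.
  (* For [d > K] the difference [N - e] is truncated to zero, but then [C(N, e)] vanishes too. *)
  rewrite h; have [dK|Kd] := leqP d K.
    by rewrite -natrB // /N -addnBAC // addnK.
  by rewrite bin_small ?mulr0 // /N ltn_subLR ?ltn_add2r // (leq_trans dle) ?leq_addl.
have -> : (K + a)%:R * (W`_d * 'C(N, e)%:R) =
    W`_d * ((d + a)%:R * 'C(N, e)%:R + (K%:R - d%:R) * 'C(N, e)%:R).
  by rewrite !natrD; ring.
by rewrite -h; ring.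
Qed.

(** The derivative of [x F] has coefficients [(K + 1) F K]. *)
Lemma worpitzky_step1_nonneg_real_rooted e W : (size W <= e.+1)%N ->
  nonneg_real_rooted W -> nonneg_real_rooted (worpitzky_step 1 e W).
Proof.
move=> szW /nonneg_real_rooted_MX h.
have -> : worpitzky_step 1 e W = theta e ('X * W).
  by rewrite /theta derivM derivX mul1r /worpitzky_step scale1r [W + _]addrC.
apply: theta_nonneg_real_rooted h.
by rewrite (leq_trans (size_polyMleq _ _)) // size_polyX.
Qed.

(** The derivative of [x^2 F] is [x] times the series with coefficients [(K + 2) F K]; the extra
    factor [X] is harmless. *)
Lemma worpitzky_step2_nonneg_real_rooted e W : (size W <= e)%N ->
  nonneg_real_rooted W -> nonneg_real_rooted (worpitzky_step 2 e W).
Proof.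
move=> szW /nonneg_real_rooted_MX /nonneg_real_rooted_MX h; apply/nonneg_real_rooted_MX.
have -> : 'X * worpitzky_step 2 e W = theta e ('X * ('X * W)).
  rewrite /theta !derivM derivX !mul1r /worpitzky_step -!mul_polyC; ring.
apply: theta_nonneg_real_rooted h.
rewrite (leq_trans (size_polyMleq _ _)) // size_polyX /= ltnS.
by rewrite (leq_trans (size_polyMleq _ _)) // size_polyX.
Qed.

(** The factors [K + 1] and [K + 2] are introduced in turn, starting from
    [(K + 1)(K + 2) = 2 C(K + 2, 2)], whose numerator is the constant 2. *)
Lemma real_rooted_worpitzky_pow n : exists P : {poly C},
  [/\ nonneg_real_rooted P, (size P <= n.*2.+1)%N &
    forall K, worpitzky n.*2.+2 P K = ((K.+1 * K.+2) ^ n.+1)%:R].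
Proof.
elim: n => [|n [P [rrP szP wP]]].
  exists 2%:P; have C2 : (2 : C) != 0 by rewrite pnatr_eq0.
  split; last 1 first.
  - move=> K; rewrite /worpitzky !big_ord_recl big_ord0 !coefC /= !mul0r !addr0.
    by rewrite -natrM addn2 subn0 -mul_bin_diag bin1 expn1 mulnC.
  - split; first by rewrite polyC_eq0.
      by move=> d; rewrite coefC; case: ifP.
    by move=> z; rewrite rootC (negbTE C2).
  - by rewrite size_polyC C2.
exists (worpitzky_step 2 n.*2.+3 (worpitzky_step 1 n.*2.+2 P)).
have szU : (size (worpitzky_step 1 n.*2.+2 P) <= n.*2.+2)%N.
  by rewrite (leq_trans (size_worpitzky_step _ _ _)).
split.
- apply: worpitzky_step2_nonneg_real_rooted; first exact: leqW.
  by apply: worpitzky_step1_nonneg_real_rooted => //; do 2 apply: leqW.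
- by rewrite (leq_trans (size_worpitzky_step _ _ _)).
- move=> K; rewrite doubleS !worpitzkyM ?wP ?(leqW (leqW szP)) ?(leqW (leqW szU)) //.
  by rewrite -!natrM (expnS (K.+1 * K.+2)%N n.+1) mulnA addn2 addn1 [(K.+2 * K.+1)%N]mulnC.
Qed.

(* Unlike its diagonal case [i = j], the inequality for all [i <= j] is stable
   under multiplication by [X + s]. *)
Definition totally_log_concave P :=
  (forall d, 0 <= P`_d) /\
  (forall i j, (i <= j)%N -> (if i is i'.+1 then P`_i' else 0) * P`_j.+1 <= P`_i * P`_j).

Lemma totally_log_concave_MXaddC P s : 0 <= s ->
  totally_log_concave P -> totally_log_concave (P * ('X + s%:P)).
Proof.
(* Shifted coefficients: [p 0 = 0] stands for the coefficient of degree -1. *)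
move=> s0 [Pge Ptlc]; pose p i := if i is i'.+1 then P`_i' else 0.
have p0 i : 0 <= p i by case: i.
have pS i : P`_i = p i.+1 by [].
have tlc i j : (i <= j)%N -> p i * p j.+2 <= p i.+1 * p j.+1 by move/Ptlc; case: i.
have E d : (P * ('X + s%:P))`_d = p d + s * p d.+1.
  by rewrite mulrDr coefD coefMX coefMC mulrC; case: d.
split=> [d|i j ij]; first by rewrite E addr_ge0 ?mulr_ge0.
rewrite !E; case: i ij => [|i] ij.
  by rewrite mul0r mulr_ge0 // addr_ge0 ?mulr_ge0.
case: j ij => // j; rewrite ltnS E => ij.
have h1 := tlc _ _ ij; have h2 := tlc i.+1 j.+1 ij.
(* This handles the coefficient of [s] in the difference below, where the products [p i.+1 * p j.+2]
   cancel. *)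
have h3 : p i * p j.+3 <= p i.+2 * p j.+1.
  have [eij|] := eqVneq i j; first by rewrite eij [leRHS]mulrC; apply: tlc.
  rewrite neq_ltn => /orP[lt|]; last by rewrite ltnNge ij.
  by apply: le_trans (tlc _ _ lt); apply: tlc; rewrite leqW.
rewrite -subr_ge0.
have -> : (p i.+1 + s * p i.+2) * (p j.+1 + s * p j.+2)
    - (p i + s * p i.+1) * (p j.+2 + s * p j.+3) =
  (p i.+1 * p j.+1 - p i * p j.+2) + s * (p i.+2 * p j.+1 - p i * p j.+3)
    + s * s * (p i.+2 * p j.+2 - p i.+1 * p j.+3) by ring.
apply: addr_ge0; first apply: addr_ge0; rewrite ?subr_ge0 //.
  by apply: mulr_ge0; rewrite ?subr_ge0.
by apply: mulr_ge0; rewrite ?mulr_ge0 ?subr_ge0.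
Qed.

(** All roots are nonpositive, so [P] is a nonnegative constant times factors [X + s] with [s >= 0],
    added one at a time. *)
Lemma nonneg_real_rooted_totally_log_concave P :
  nonneg_real_rooted P -> totally_log_concave P.
Proof.
move=> Prr; have [P0 Pge Pr] := Prr; have [r Er] := closed_field_poly_normal P.
have lP : 0 <= lead_coef P by apply: Pge.
have : forall s, s \in r -> s <= 0.
  move=> s sr; apply: nonneg_real_rooted_le0 Prr _.
  by rewrite Er rootZ ?lead_coef_eq0 // root_prod_XsubC.
rewrite Er; move: (lead_coef P) lP => c c0 {P P0 Pge Pr Prr Er}.
elim: r => [|s r IH] rle.
  rewrite big_nil alg_polyC; split=> [d|i j ij]; first by rewrite coefC; case: ifP.
  by rewrite !coefC /= mulr0; case: ifP; case: ifP => *; rewrite ?mulr_ge0 ?mulr0 ?mul0r.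
rewrite big_cons mulrC scalerAl -[s]opprK polyCN opprK.
apply: totally_log_concave_MXaddC; first by rewrite oppr_ge0 rle ?mem_head.
by apply: IH => t tr; apply: rle; rewrite inE tr orbT.
Qed.

End NonnegRealRooted.

(** * Worpitzky identities and log-concavity *)

Section Shape.
Variables (b : nat -> nat) (D : nat).
Hypothesis tlc : forall i j, (i < j)%N -> (j <= D)%N -> (b i * b j <= b i.+1 * b j.-1)%N.
Let s := mkseq (fun d => (b d)%:Z) D.+1.

Lemma mkseq_log_concave : log_concave s.
Proof.
move=> [//|i] _; rewrite size_mkseq ltnS => iD; rewrite !nth_mkseq //; try lia.
have := tlc (leqW (ltnSn i)) iD.
by rewrite expr2 -!PoszM lez_nat.
Qed.

(** The peak is a maximum [b m]. For [i < m], [b i * b m <= b i.+1 * b m.-1 <= b i.+1 * b m] and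
    [b m] cancels; the other side is symmetric. Comparing with the distant index [m] takes care of
    internal zeros. *)
Lemma mkseq_unimodal : unimodal s.
Proof.
have [m _ mmax] := @arg_maxnP 'I_D.+1 ord0 predT (fun i => b i) isT.
have {}mmax i : (i <= D)%N -> (b i <= b m)%N.
  by move=> iD; apply: (mmax (Ordinal (iD : (i < D.+1)%N))).
have mD : (m <= D)%N by rewrite -ltnS.
exists m; first by rewrite size_mkseq.
have [bm0|bm] := posnP (b m).
  have b0 i : (i <= D)%N -> b i = 0%N by move=> /mmax; rewrite bm0 leqn0 => /eqP.
  by split=> [i im|i mi]; rewrite ?size_mkseq => *; rewrite !nth_mkseq ?b0 //; lia.
split=> [i im|i mi]; rewrite ?size_mkseq => *; rewrite !nth_mkseq ?lez_nat; try lia.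
  rewrite -(leq_pmul2r bm) (leq_trans (tlc im mD)) // leq_mul2l.
  by rewrite mmax ?orbT; lia.
rewrite -(leq_pmul2l bm) (leq_trans (tlc _ _)) //= leq_mul2r.
have [mDe|] := eqVneq (m : nat) D; first by lia.
by rewrite mmax ?orbT; lia.
Qed.
End Shape.

(** * From a Worpitzky identity to real-rootedness *)

Section FromWorpitzky.
Variables (n : nat) (b : nat -> nat).
Let D := n.*2.
Hypothesis binP : forall K, ('C(K.+1, 2) ^ n.+1 =
  'C(K, 2) ^ n.+1 + \sum_(d < D.+1) b d * 'C(K + D - d, D.+1))%N.

(** Summing [binP] over [K] amounts to dividing the generating function by [1 - x]. *)
Lemma worpitzky_summed K :
  ('C(K.+2, 2) ^ n.+1 = \sum_(d < D.+1) b d * 'C(K + D.+2 - d, D.+2))%N.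
Proof.
elim: K => [|K IH].
  rewrite (binP 1) bin_small // exp0n // add0n.
  apply: eq_bigr => -[[|d] /= dD] _; first by rewrite !subn0 add1n add0n !binn.
  by rewrite !bin_small; lia.
rewrite binP IH -big_split; apply: eq_bigr => -[d /= dD] _.
rewrite -mulnDr; congr (_ * _)%N.
have -> : (K.+1 + D.+2 - d = (K + D.+2 - d).+1)%N by lia.
by rewrite binS; congr (_ + 'C(_, _))%N; lia.
Qed.

Lemma coef_sum_monomials (R : nzRingType) d :
  (\sum_(i < D.+1) (b i)%:R *: 'X^i : {poly R})`_d = if (d < D.+1)%N then (b d)%:R else 0.
Proof.
rewrite coef_sum; case: ltnP => [dD|Dd].
  rewrite (bigD1 (Ordinal dD)) //= coefZ coefXn eqxx mulr1 big1 ?addr0 // => i.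
  by rewrite -val_eqE /= coefZ coefXn eq_sym => /negbTE ->; rewrite mulr0.
rewrite big1 // => i _; rewrite coefZ coefXn; case: eqP => [e|]; last by rewrite mulr0.
by have := ltn_ord i; rewrite -e ltnNge Dd.
Qed.

Lemma worpitzky_poly_nonneg_real_rooted (C : numClosedFieldType) :
  nonneg_real_rooted (\sum_(d < D.+1) (b d)%:R *: 'X^d : {poly C}).
Proof.
set B := \sum_(_ < _) _.
have coefB d : B`_d = if (d < D.+1)%N then (b d)%:R else 0 by exact: coef_sum_monomials.
have [P [[P0 Pge Pr] szP wP]] := real_rooted_worpitzky_pow C n.
have two0 : 2 ^+ n.+1 != 0 :> C by rewrite expf_neq0 // pnatr_eq0.
(* Both sides have the same [worpitzky] values, since [(K + 1)(K + 2) = 2 C(K + 2, 2)]. *)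
suff PB : P = 2 ^+ n.+1 *: B.
  split; first by move: P0; rewrite PB scaler_eq0 negb_or => /andP[].
    by move=> d; rewrite coefB; case: ifP.
  by move=> z rz; apply: Pr; rewrite PB rootZ.
have szB : (size (2 ^+ n.+1 *: B)%R <= D.+1)%N.
  apply/leq_sizeP => d Dd; rewrite coefZ coefB ltnNge Dd mulr0 //.
apply: (@worpitzky_inj _ D.+2); try by do 2 apply: leqW.
move=> K; rewrite wP /worpitzky 2!big_ord_recr /= !coefZ !coefB ltnn.
rewrite [in (_ < D.+1)%N]ltnNge leqW // mulr0 !mul0r !addr0.
transitivity ((2 ^ n.+1 * 'C(K.+2, 2) ^ n.+1)%:R : C).
  by rewrite -expnMn -mul_bin_diag bin1 mulnC.
rewrite worpitzky_summed natrM natr_sum natrX mulr_sumr; apply: eq_bigr => i _.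
by rewrite coefZ coefB ltn_ord natrM mulrA.
Qed.

Lemma worpitzky_coef_log_concave (C : numClosedFieldType) i j :
  (i < j)%N -> (j <= D)%N -> (b i * b j <= b i.+1 * b j.-1)%N.
Proof.
case: j => // j ij jD.
have [_] := nonneg_real_rooted_totally_log_concave (worpitzky_poly_nonneg_real_rooted C).
rewrite /= in jD *; have [eij|ne] := eqVneq i j; first by rewrite eij mulnC.
have ij' : (i < j)%N by lia.
move/(_ i.+1 j ij'); rewrite /= !coef_sum_monomials.
rewrite !ifT; try lia.
by rewrite -!natrM ler_nat.
Qed.
End FromWorpitzky.

(** * Interval configurations *)

Section Configurations.
Local Open Scope nat_scope.
Variable n : nat.

Definition interval_config m (c : {ffun 'I_n -> 'I_m * 'I_m}) : bool :=
  [forall i, (c i).1 <= (c i).2] && [exists i, (c i).1 == (c i).2].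

Definition endpoints m (c : {ffun 'I_n -> 'I_m * 'I_m}) : {set 'I_m} :=
  [set j | [exists i, (j == (c i).1) || (j == (c i).2)]].

Definition surj_config m : {set {ffun 'I_n -> 'I_m * 'I_m}} :=
  [set c | interval_config c && (endpoints c == setT)].

Lemma sum_ord_lt m j : j <= m -> \sum_(i < m | i < j) 1 = j.
Proof. by move=> jm; rewrite -(big_ord_widen _ (fun=> 1)) // sum1_card card_ord. Qed.

Lemma card_pairs m (f : nat -> nat) : (forall j, j < m -> f j <= m) ->
  #|[set p : 'I_m * 'I_m | p.1 < f p.2]| = \sum_(j < m) f j.
Proof.
move=> fm; rewrite cardsE -sum1_card big_mkcond.
rewrite (eq_bigr (fun p : 'I_m * 'I_m => if p.1 < f p.2 then 1 else 0)); last by case.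
rewrite -(pair_big predT predT (fun i j : 'I_m => if i < f j then 1 else 0)) /=.
rewrite exchange_big; apply: eq_bigr => j _ /=.
by rewrite -big_mkcond sum_ord_lt ?fm.
Qed.

(** [C(m + 1, 2)] counts the pairs [a <= b] and [C(m, 2)] the pairs [a < b]; a family of the first
    kind that is not entirely of the second has an interval of length zero. *)
Lemma card_interval_config m : 0 < n ->
  'C(m.+1, 2) ^ n = 'C(m, 2) ^ n + #|[set c : {ffun 'I_n -> 'I_m * 'I_m} | interval_config c]|.
Proof.
move=> n0.
have H f : (forall j, j < m -> f j <= m) ->
    #|[set c : {ffun 'I_n -> 'I_m * 'I_m} | [forall i, (c i).1 < f (c i).2]]|
      = (\sum_(j < m) f j) ^ n.
  move=> fm; rewrite -card_pairs // -[X in _ ^ X]card_ord -card_ffun_on; apply: eq_card => c.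
  by rewrite inE; apply/forallP/ffun_onP => h i; move: (h i); rewrite inE.
have Hlt := H id (fun j h => ltnW h); have Hle := H S (fun j h => h).
have <- : \sum_(j < m) j.+1 = 'C(m.+1, 2).
  by rewrite -bin2_sum big_nat_recl // add0n big_mkord.
have <- : \sum_(j < m) j = 'C(m, 2) by rewrite -bin2_sum big_mkord.
rewrite -Hle -Hlt -(cardsID [set c : {ffun 'I_n -> 'I_m * 'I_m} | [forall i, (c i).1 < (c i).2]]).
congr (_ + _); apply: eq_card => c; rewrite !inE.
  by apply/andP/idP => [[]//|lt]; split=> //; apply/forallP => i; rewrite ltnS ltnW ?(forallP lt).
rewrite /interval_config andbC; apply: andb_id2l => /forallP le.
rewrite negb_forall; apply: eq_existsb => i.
by rewrite -leqNgt -val_eqE /= eqn_leq; have := le i; rewrite ltnS => ->.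
Qed.

(** Relabel along the increasing bijection from ['I_#|A|] onto [A]. *)
Lemma card_endpoints_eq m (A : {set 'I_m}) :
  #|[set c : {ffun 'I_n -> 'I_m * 'I_m} | interval_config c & endpoints c == A]| =
  #|surj_config #|A| |.
Proof.
pose g (c : {ffun 'I_n -> 'I_#|A| * 'I_#|A|}) : {ffun 'I_n -> 'I_m * 'I_m} :=
  [ffun i => (Order.enum_val (c i).1, Order.enum_val (c i).2)].
have ginj : injective g.
  move=> c c' /ffunP e; apply/ffunP => i; have := e i; rewrite !ffunE => -[].
  move=> /Order.enum_val_inj e1 /Order.enum_val_inj e2.
  by apply/eqP; rewrite -pair_eqE /= /pair_eq e1 e2 !eqxx.
have gle (c : {ffun 'I_n -> 'I_#|A| * 'I_#|A|}) : interval_config (g c) = interval_config c.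
  congr (_ && _); [apply: eq_forallb | apply: eq_existsb] => i; rewrite ffunE /=.
    by have := @Order.le_enum_val _ 'I_m (@le_total _ _) (mem A) (c i).1 (c i).2; rewrite !leEord.
  by rewrite (inj_eq (@Order.enum_val_inj _ _ _)).
have gend (c : {ffun 'I_n -> 'I_#|A| * 'I_#|A|}) :
    endpoints (g c) = [set Order.enum_val j | j in endpoints c].
  apply/setP => j; rewrite inE; apply/existsP/imsetP => [[ i]|[x]].
    rewrite ffunE /= => /orP[]/eqP->; [exists (c i).1|exists (c i).2] => //;
      by rewrite inE; apply/existsP; exists i; rewrite eqxx ?orbT.
  by rewrite inE => /existsP[i /orP[]/eqP e] ->; exists i; rewrite ffunE /= e eqxx ?orbT.
rewrite -(card_imset _ ginj); apply: eq_card => c; rewrite inE.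
apply/andP/imsetP => [[ic /eqP ec]|[c']].
  have cA i : ((c i).1 \in A) && ((c i).2 \in A).
    by rewrite -ec !inE; apply/andP; split; apply/existsP; exists i; rewrite eqxx ?orbT.
  have cA1 i := proj1 (andP (cA i)); have cA2 i := proj2 (andP (cA i)).
  have [c' Ec] : exists c', c = g c'.
    exists [ffun i => (Order.enum_rank_in (cA1 i) (c i).1, Order.enum_rank_in (cA1 i) (c i).2)].
    apply/ffunP => i; rewrite !ffunE /= !Order.enum_rankK_in //; exact: surjective_pairing.
  exists c' => //.
  rewrite inE -gle -Ec ic /=; apply/eqP/setP => j.
  have : Order.enum_val j \in endpoints c by rewrite ec Order.enum_valP.
  by rewrite Ec gend mem_imset ?inE //; exact: Order.enum_val_inj.
rewrite inE => /andP[ic /eqP ec] ->; rewrite gle ic gend ec; split=> //.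
apply/eqP/setP => j; apply/imsetP/idP => [[x _ ->]|jA]; first exact: Order.enum_valP.
by exists (Order.enum_rank_in jA j); rewrite ?Order.enum_rankK_in.
Qed.

(** Configurations are grouped by endpoint set, and these sets by cardinality. *)
Lemma binomial_surj_config m : 0 < n ->
  'C(m.+1, 2) ^ n = 'C(m, 2) ^ n + \sum_(j < m.+1) 'C(m, j) * #|surj_config j|.
Proof.
move=> n0; rewrite card_interval_config //; congr (_ + _).
rewrite -sum1_card (partition_big (@endpoints m) predT) //=.
have E (A : {set 'I_m}) :
    \sum_(c in [set c | interval_config c] | endpoints c == A) 1 = #|surj_config #|A| |.
  rewrite -card_endpoints_eq -sum1_card; apply: eq_bigl => c; by rewrite !inE.
under eq_bigr do rewrite E.
have cA (A : {set 'I_m}) : #|A| < m.+1 by rewrite ltnS -[X in _ <= X]card_ord max_card.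
rewrite (partition_big (fun A : {set 'I_m} => inord #|A| : 'I_m.+1) predT) //=.
apply: eq_bigr => j _.
rewrite (eq_bigr (fun _ => #|surj_config j|)); last first.
  by move=> A /eqP <-; rewrite inordK.
rewrite sum_nat_const; congr (_ * _).
rewrite -[X in 'C(X, _)]card_ord -card_draws; apply: eq_card => A.
by rewrite inE; apply/eqP/eqP => /= e; [move: e|]; rewrite inordK.
Qed.

End Configurations.

(** * Bipermutations with cuts *)

Section Cuts.
Local Open Scope nat_scope.
Variable d : nat.
Implicit Types M : {set 'I_d}.

(** An element [x] of [M] is a cut between positions [x] and [x.+1]; [block M p] numbers the block
    containing position [p]. *)
Definition block M p := #|[set x in M | x < p]|.

Lemma blockS M (x : 'I_d) : block M x.+1 = (x \in M) + block M x.
Proof.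
rewrite /block (cardsD1 x) !inE ltnS leqnn andbT; congr (_ + _).
by apply: eq_card => y; rewrite !inE ltnS ltn_neqAle andbCA.
Qed.

Lemma block0 M : block M 0 = 0.
Proof. by apply/eqP; rewrite cards_eq0; apply/eqP/setP => x; rewrite !inE andbF. Qed.

Lemma block_max M : block M d = #|M|.
Proof. by apply: eq_card => x; rewrite inE ltn_ord andbT. Qed.

Lemma block_mono M : {homo block M : p q / p <= q}.
Proof.
move=> p q pq; apply/subset_leq_card/subsetP => x; rewrite !inE => /andP[-> xp].
exact: leq_trans pq.
Qed.

Lemma block_le M p : block M p <= #|M|.
Proof. by apply/subset_leq_card/subsetP => x; rewrite !inE => /andP[]. Qed.

Lemma block_onto M j : j <= #|M| -> exists2 p, p <= d & block M p = j.
Proof.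
move=> jM.
have : exists p, j <= block M p by exists d; rewrite block_max.
case/ex_minnP => -[|p] jp pmin; first by exists 0; move: jp; rewrite ?block0; lia.
have h : block M p < j by rewrite ltnNge; apply/negP => /pmin; rewrite ltnn.
have pd : p < d.
  rewrite ltnNge; apply/negP => dp; have := block_mono M dp; rewrite block_max; lia.
by exists p.+1 => //; move: jp; rewrite (blockS M (Ordinal pd)); case: (_ \in M) => /=; lia.
Qed.

(** A nondecreasing sequence that skips no value rises by 0 or 1 at each step, so it counts its own
    jumps. *)
Lemma block_jumps (v : nat -> nat) m :
  (forall p, p < d -> v p <= v p.+1) -> (forall p, p <= d -> v p <= m) ->
  (forall j, j <= m -> exists2 p, p <= d & v p = j) ->
  forall p, p <= d -> block [set x : 'I_d | v x != v x.+1] p = v p.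
Proof.
move=> vmono vle vsurj.
have vm p q : p <= q -> q <= d -> v p <= v q.
  elim: q => [|q IH]; first by rewrite leqn0 => /eqP->.
  rewrite leq_eqVlt => /orP[/eqP->//|pq] qd.
  exact: leq_trans (IH pq (ltnW qd)) (vmono _ qd).
have v0 : v 0 = 0.
  by have [p pd vp] := vsurj 0 (leq0n m); apply/eqP; rewrite -leqn0 -[X in _ <= X]vp vm.
elim=> [|p IH] pd; first by rewrite block0 v0.
rewrite (blockS _ (Ordinal pd)) /= IH ?(ltnW pd) // inE /=.
have vp := vmono _ pd; have vS := vle _ pd.
have [//|ne] := eqVneq (v p) (v p.+1).
have [|q qd vq] := vsurj (v p).+1; first by lia.
have [qp|pq] := leqP q p; first by have := vm _ _ qp (ltnW pd); lia.
have := vm _ _ pq qd; lia.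
Qed.

End Cuts.

Section Positions.
Local Open Scope nat_scope.
Variable T : eqType.
Implicit Types (s : seq T) (x : T).

Definition last_index x s := (size s).-1 - index x (rev s).

Lemma index_take x0 s p : p < size s -> nth x0 s p \notin take p s ->
  index (nth x0 s p) s = p.
Proof.
move=> ps h; rewrite -{2}(cat_take_drop p s) index_cat (negbTE h).
by rewrite (drop_nth x0) //= eqxx addn0 size_take ps.
Qed.

Lemma last_index_drop x0 s p : p < size s -> nth x0 s p \notin drop p.+1 s ->
  last_index (nth x0 s p) s = p.
Proof.
move=> ps h; rewrite /last_index.
have := @index_take x0 (rev s) (size s - p.+1).
rewrite size_rev nth_rev; last by lia.
have -> : size s - (size s - p.+1).+1 = p by lia.
by rewrite take_rev subKn // mem_rev => -> //; lia.
Qed.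

Lemma mem_drop_last_index x s p : x \in s -> 0 < p -> (x \in drop p s) = (p <= last_index x s).
Proof.
move=> xs p0; rewrite /last_index -mem_rev rev_drop in_take ?mem_rev //.
have : index x (rev s) < size s by rewrite -size_rev index_mem mem_rev.
lia.
Qed.

End Positions.

Section IsConfig.
Local Open Scope nat_scope.
Variable n : nat.
Implicit Types a b : 'I_n -> nat.

(** The conditions of [surj_config] for endpoints in [nat]. They cover words, where [m = 2 * n - 2]
    and each position is its own block, as well as their coarsenings. *)
Definition is_config m a b := [/\ forall i, a i <= b i, forall i, b i <= m,
  exists i, a i = b i & forall j, j <= m -> exists i, a i = j \/ b i = j].

Lemma is_config_block m (M : {set 'I_m}) a b : is_config m a b ->
  is_config #|M| (fun i => block M (a i)) (fun i => block M (b i)).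
Proof.
case=> [ab bm [k ek] surj]; split=> [i|i||j /block_onto[p /surj[i h] <-]].
- exact/block_mono/ab.
- exact: block_le.
- by exists k; rewrite ek.
- by exists i; case: h => ->; [left | right].
Qed.

Lemma is_config_surj m (c : {ffun 'I_n -> 'I_m.+1 * 'I_m.+1}) : c \in surj_config n m.+1 <->
  is_config m (fun i => (c i).1) (fun i => (c i).2).
Proof.
rewrite inE; split=> [/andP[/andP[/forallP le /existsP[k /eqP ek]] /eqP surj]|].
  split=> [//|i||j jm]; [by rewrite -ltnS | by exists k; rewrite ek |].
  have : (inord j : 'I_m.+1) \in endpoints c by rewrite surj inE.
  rewrite inE => /existsP[i /orP h]; exists i.
  by case: h => /eqP <-; rewrite inordK; [left | | right |].
move=> [le _ [k ek] surj]; apply/andP; split; first (apply/andP; split).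
- exact/forallP.
- by apply/existsP; exists k; apply/eqP/val_inj.
- apply/eqP/setP => j; rewrite !inE; apply/existsP.
  have [|i h] := surj j; first by rewrite -ltnS.
  by exists i; rewrite -!val_eqE /= ![j == _ :> nat]eq_sym; case: h => ->; rewrite eqxx ?orbT.
Qed.

End IsConfig.

(** * Letters of a bipermutation and their total order *)

Section Letters.
Local Open Scope nat_scope.
Variables (n : nat) (k : 'I_n).

Definition letters (B : seq 'I_n) : seq ('I_n * bool) :=
  [seq (nth k B p, barred k B p) | p <- iota 0 (size B)].

Definition all_letters : seq ('I_n * bool) :=
  [seq (i, false) | i <- enum 'I_n] ++ [seq (i, true) | i <- enum 'I_n & i != k].

Lemma uniq_all_letters : uniq all_letters.
Proof.
rewrite cat_uniq; apply/and3P; split.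
- by rewrite map_inj_uniq ?enum_uniq // => ? ? [].
- by apply/hasPn => _ /mapP[i _ ->]; apply/negP => /mapP[].
- by rewrite map_inj_uniq => [|? ? [] //]; apply/filter_uniq/enum_uniq.
Qed.

Lemma mem_all_letters i b : ((i, b) \in all_letters) = ~~ b || (i != k).
Proof.
rewrite mem_cat; apply/orP/idP => [[/mapP[j _ [-> ->]]//|/mapP[j]]|].
  by rewrite mem_filter => /andP[jk _] [-> ->]; rewrite jk orbT.
case: b => /= h; [right|left]; apply/mapP; exists i => //.
  by rewrite mem_filter h mem_enum.
by rewrite mem_enum.
Qed.

Lemma count_all_letters i : count (fun l => l.1 == i) all_letters = (i != k).+1.
Proof.
transitivity (count_mem i (enum 'I_n) + count_mem i [seq i <- enum 'I_n | i != k]).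
  by rewrite count_cat !count_map.
rewrite (count_uniq_mem _ (enum_uniq _)) (count_uniq_mem _ (filter_uniq _ (enum_uniq _))).
by rewrite mem_filter !mem_enum andbT.
Qed.

Lemma size_all_letters : size all_letters = 2 * n - 1.
Proof.
rewrite size_cat [size (map _ _)]size_map [X in _ + X]size_map size_enum_ord size_filter.
have := count_predC (pred1 k) (enum 'I_n).
rewrite count_uniq_mem ?enum_uniq // mem_enum size_enum_ord => e.
rewrite (eq_count (a2 := predC (pred1 k))) //. move: e; rewrite /= ; lia.
Qed.

(* Adjacent letters form a descent exactly when the value of [key] drops, which
   is a total order on letters: unbarred letters below [k], increasing; barred
   letters and [k], decreasing; unbarred letters above [k], increasing. *)
Definition key (l : 'I_n * bool) : nat :=
  if l.2 || (l.1 == k) then 2 * n - l.1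
  else if l.1 < k then (l.1 : nat) else 2 * n + l.1.

Lemma key_lt l : key l < 4 * n.
Proof. by rewrite /key; have := ltn_ord l.1; case: ifP => _; last (case: ifP => _); lia. Qed.

(** The three classes of letters have keys in [[0, n)], [(n, 2n]] and [(2n, 3n)]. *)
Lemma key_inj : {in all_letters &, injective key}.
Proof.
move=> [i b] [j c]; rewrite !mem_all_letters /key /= -!val_eqE /= => hb hc e.
have ij : i = j.
  apply: val_inj; move: e hb hc; have := ltn_ord i; have := ltn_ord j; have := ltn_ord k.
  by case: b; case: c => /=; case: (ltngtP i k) => /= ?; case: (ltngtP j k) => /= ?; lia.
rewrite -ij in e hc *; congr (_, _).
move: e hb hc; have := ltn_ord i; have := ltn_ord k.
by case: b; case: c => /=; case: (ltngtP i k) => /= ?; lia.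
Qed.

Section AtWord.
Variable B : seq 'I_n.
Hypothesis szB : size B = 2 * n - 1.
Hypothesis bipB : is_bipermutation_at k B.

Lemma count_bip i : count_mem i B = (i != k).+1.
Proof.
have [ck /forallP h] := andP bipB.
by have [->|ik] := eqVneq i k; [apply/eqP | apply/eqP; have := h i; rewrite ik].
Qed.

Lemma mem_bip i : i \in B.
Proof. by rewrite -has_pred1 has_count count_bip. Qed.

Lemma size_letters : size (letters B) = size B.
Proof. by rewrite size_map size_iota. Qed.

Lemma nth_letters p : p < size B ->
  nth (k, false) (letters B) p = (nth k B p, barred k B p).
Proof. by move=> ps; rewrite (nth_map 0) ?size_iota // nth_iota // add0n. Qed.

Lemma count_split p : p < size B ->
  count_mem (nth k B p) B =
  count_mem (nth k B p) (take p B) + (count_mem (nth k B p) (drop p.+1 B)).+1.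
Proof.
move=> ps; rewrite -{2}(cat_take_drop p B) count_cat (drop_nth k ps) /= eqxx; congr (_ + _).
Qed.

Lemma barred_drop p : p < size B -> barred k B p || (nth k B p == k) ->
  nth k B p \notin drop p.+1 B.
Proof.
move=> ps h; have := count_split ps; rewrite count_bip.
rewrite -!has_pred1 !has_count /barred in h *.
by case: eqP h => e; rewrite ?orbF -?has_pred1 ?has_count /=; lia.
Qed.

Lemma barred_neq p : p < size B -> barred k B p -> nth k B p != k.
Proof.
move=> ps; have := count_split ps; rewrite count_bip.
by rewrite /barred -has_pred1 has_count /=; case: eqP; lia.
Qed.

Definition position (l : 'I_n * bool) :=
  if l.2 then last_index l.1 B else index l.1 B.

Lemma position_nth p : p < size B -> position (nth (k, false) (letters B) p) = p.
Proof.
move=> ps; rewrite nth_letters // /position /=; case: ifP => b.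
  by apply: last_index_drop => //; rewrite barred_drop // b.
by apply: index_take => //; rewrite -/(barred _ _ _) b.
Qed.

Lemma last_index_special : last_index k B = index k B.
Proof.
have kB : index k B < size B by rewrite index_mem mem_bip.
have e : nth k B (index k B) = k by rewrite nth_index ?mem_bip.
by rewrite -{1}e last_index_drop // barred_drop // e eqxx orbT.
Qed.

Lemma uniq_letters : uniq (letters B).
Proof.
apply/(uniqP (k, false)) => p q; rewrite !inE size_letters => ps qs e.
by rewrite -(position_nth ps) e position_nth.
Qed.

Lemma perm_letters : perm_eq (letters B) all_letters.
Proof.
have sub : {subset letters B <= all_letters}.
  move=> l /(nthP (k, false))[p]; rewrite size_letters => ps <-.
  rewrite nth_letters // mem_all_letters.
  by case b: (barred k B p) => //=; apply: barred_neq.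
apply: uniq_perm; rewrite ?uniq_letters ?uniq_all_letters //.
have [|//] := uniq_min_size uniq_letters sub.
by rewrite size_letters szB size_all_letters.
Qed.

Lemma letter_positionE l : l \in all_letters ->
  position l < size B /\ nth (k, false) (letters B) (position l) = l.
Proof.
rewrite -(perm_mem perm_letters) => /(nthP (k, false))[p]; rewrite size_letters => ps <-.
by rewrite position_nth.
Qed.

Lemma index_le_last_index i : index i B <= last_index i B.
Proof.
have [->|ik] := eqVneq i k; first by rewrite last_index_special.
have h : (i, true) \in all_letters by rewrite mem_all_letters ik.
have [pl /(congr1 fst)] := letter_positionE h.
rewrite nth_letters // => e; rewrite /position /= in pl e.
by rewrite -ltnS -in_take ?mem_bip // (take_nth k) // mem_rcons e mem_head.
Qed.

Lemma is_config_word : is_config (2 * n - 2) (fun i => index i B) (fun i => last_index i B).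
Proof.
split=> [i|i||p pD]; first exact: index_le_last_index.
- by rewrite /last_index szB; lia.
- by exists k; rewrite last_index_special.
- have ps : p < size B by have := ltn_ord k; lia.
  exists (nth k B p); have := position_nth ps; rewrite nth_letters // /position /=.
  by case: ifP; [right | left].
Qed.

Lemma descent_key p : p.+1 < size B -> descent k B p =
  (key (nth (k, false) (letters B) p.+1) < key (nth (k, false) (letters B) p)).
Proof.
move=> ps1; have ps := ltnW ps1; rewrite !nth_letters //.
(* Besides the clauses of [descent], the case analysis needs that adjacent letters differ and that
   [k] is never barred. *)
have ne : (nth k B p, barred k B p) != (nth k B p.+1, barred k B p.+1).
  by rewrite -!nth_letters // nth_uniq ?uniq_letters ?size_letters // neq_ltn ltnSn.
have h1 := barred_neq ps; have h2 := barred_neq ps1.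
move: ne h1 h2; rewrite /descent /key /= -pair_eqE /= /pair_eq /= -!val_eqE /=.
have := ltn_ord (nth k B p); have := ltn_ord (nth k B p.+1); have := ltn_ord k.
move: (nth k B p : nat) (nth k B p.+1 : nat) (k : nat) (barred k B p) (barred k B p.+1).
move=> i j k' [] []; rewrite /=; case: (ltngtP i k') => /= ?; case: (ltngtP j k') => /= ?; lia.
Qed.

End AtWord.
End Letters.

(** * Coarsening a bipermutation along a set of cuts *)

Section Coarsening.
Local Open Scope nat_scope.
Variables (n m : nat).
Local Notation config := {ffun 'I_n -> 'I_m.+1 * 'I_m.+1}.

Definition level (c : config) (l : 'I_n * bool) : nat := if l.2 then (c l.1).2 else (c l.1).1.

(** Encodes the lexicographic order by level, then [key], which stays below [4 * n]. *)
Definition weight k (c : config) (l : 'I_n * bool) := level c l * (4 * n) + key k l.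

Definition coarsen (B : seq 'I_n) (M : {set 'I_(2 * n - 2)}) : config :=
  [ffun i => (inord (block M (index i B)), inord (block M (last_index i B)))].

Lemma weight_inj k c : {in all_letters k &, injective (weight k c)}.
Proof.
move=> l l' hl hl' e; apply: (key_inj hl hl').
have := congr1 (modn^~ (4 * n)) e.
by rewrite !modnMDl !modn_small ?key_lt.
Qed.

Lemma weight_level k c l l' : weight k c l <= weight k c l' -> level c l <= level c l'.
Proof.
rewrite /weight => h; rewrite leqNgt; apply/negP => lt.
have := key_lt k l'; move: (4 * n) h => N h; have := leq_mul2r N (level c l').+1 (level c l).
by rewrite lt orbT mulSn; lia.
Qed.

Section AtWord.
Variables (k : 'I_n) (B : seq 'I_n) (M : {set 'I_(2 * n - 2)}).
Hypothesis szB : size B = 2 * n - 1.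
Hypothesis bipB : is_bipermutation_at k B.
Hypothesis cardM : #|M| = m.
Hypothesis desM : [set x : 'I_(2 * n - 2) | descent k B x] \subset M.
Let c := coarsen B M.
Let l_ p := nth (k, false) (letters k B) p.

Lemma coarsenE i :
  ((c i).1 = block M (index i B) :> nat) /\ ((c i).2 = block M (last_index i B) :> nat).
Proof. by rewrite ffunE /= !inordK // ltnS -cardM block_le. Qed.

Lemma level_coarsen l : level c l = block M (position B l).
Proof. by rewrite /level /position; case: ifP => _; case: (coarsenE l.1). Qed.

Lemma level_nth p : p < size B -> level c (l_ p) = block M p.
Proof. by move=> ps; rewrite level_coarsen position_nth. Qed.

(** Across a cut the level rises; inside a block there is no descent, so [key] does not drop. Hence
    sorting recovers the word from its coarsening. *)
Lemma sorted_weight : sorted (relpre (weight k c) leq) (letters k B).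
Proof.
apply/(sortedP (k, false)) => p; rewrite size_letters => ps1.
have ps := ltnW ps1; have pD : p < 2 * n - 2 by lia.
rewrite /= /weight -!/(l_ _) !level_nth // (blockS M (Ordinal pD)).
have := key_lt k (l_ p); have := key_lt k (l_ p.+1).
have [_|xM] := boolP (_ \in M).
  by rewrite /= add1n; move: (block M p) (4 * n) => b N; rewrite mulSn; lia.
have : ~~ descent k B p by apply: contra xM => d; apply: (subsetP desM); rewrite inE.
by rewrite descent_key // -!/(l_ _) /= add0n leq_add2l -leqNgt.
Qed.

Lemma weight_nth_mono p q : p <= q -> q < size B -> weight k c (l_ p) <= weight k c (l_ q).
Proof.
move=> pq qs.
have /= := sorted_leq_nth (leT := relpre (weight k c) leq)
  (fun y x z => @leq_trans (weight k c y) _ _) (fun x => leqnn _) (k, false) sorted_weight.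
by apply; rewrite // inE size_letters // (leq_ltn_trans pq).
Qed.

Lemma coarsen_special : (c k).1 = (c k).2.
Proof.
apply: val_inj; have [/= -> ->] := coarsenE k.
by rewrite (last_index_special szB bipB).
Qed.

(** If [i > k] had both occurrences in one block, the unbarred one would come first although its key
    [2n + i] exceeds the barred key [2n - i]. *)
Lemma coarsen_loop_le i : (c i).1 = (c i).2 -> i <= k.
Proof.
move=> e; rewrite leqNgt; apply/negP => ki.
have ik : i != k by rewrite -val_eqE /=; lia.
have hT : (i, true) \in all_letters k by rewrite mem_all_letters ik.
have hF : (i, false) \in all_letters k by rewrite mem_all_letters.
have [pT lT] := letter_positionE szB bipB hT.
have [pF lF] := letter_positionE szB bipB hF.
have lt : position B (i, false) <= position B (i, true) by apply: index_le_last_index szB bipB i.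
have := weight_nth_mono lt pT; rewrite /l_ lT lF /weight /level /= e /key /= -!val_eqE /=.
have := ltn_ord i; case: (ltngtP i k) ki => // ki _; lia.
Qed.

Lemma mem_coarsen_cut (x : 'I_(2 * n - 2)) :
  (x \in M) = (level c (l_ x) != level c (l_ x.+1)).
Proof. by have := ltn_ord x => xD; rewrite !level_nth ?blockS; case: (x \in M); lia. Qed.

Lemma coarsen_surj_config : c \in surj_config n m.+1.
Proof.
apply/is_config_surj; have [le bm [i ei] surj] := is_config_block M (is_config_word szB bipB).
split=> [j|j||j jm]; rewrite ?(coarsenE j).1 ?(coarsenE j).2 //.
- by rewrite -cardM.
- by exists i; rewrite (coarsenE i).1 (coarsenE i).2.
- by have [|i' h] := surj j; rewrite ?cardM //; exists i'; rewrite (coarsenE i').1 (coarsenE i').2.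
Qed.

End AtWord.

(** The letter [k] is the largest with an interval of length zero, the word is [all_letters k]
    sorted by an injective weight, and the cuts are the jumps of the level. *)
Lemma coarsen_inj (k k' : 'I_n) (B B' : seq 'I_n) (M M' : {set 'I_(2 * n - 2)}) :
  size B = 2 * n - 1 -> is_bipermutation_at k B -> #|M| = m ->
  [set x : 'I_(2 * n - 2) | descent k B x] \subset M ->
  size B' = 2 * n - 1 -> is_bipermutation_at k' B' -> #|M'| = m ->
  [set x : 'I_(2 * n - 2) | descent k' B' x] \subset M' ->
  coarsen B M = coarsen B' M' -> B = B' /\ M = M'.
Proof.
move=> sB bB cM dM sB' bB' cM' dM' e.
have kk : k = k'.
  apply/val_inj/eqP; rewrite /= eqn_leq; apply/andP; split.
    by apply: (coarsen_loop_le sB' bB' cM' dM'); rewrite -e (coarsen_special sB bB).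
  by apply: (coarsen_loop_le sB bB cM dM); rewrite e (coarsen_special sB' bB').
rewrite -kk in bB' dM'.
have L : letters k B = letters k B'.
  have pB := perm_letters sB bB; have pB' := perm_letters sB' bB'.
  have := sorted_weight sB bB cM dM; have := sorted_weight sB' bB' cM' dM'; rewrite e.
  rewrite -!sorted_map => s' s.
  have ew : map (weight k (coarsen B' M')) (letters k B) =
      map (weight k (coarsen B' M')) (letters k B').
    apply: sorted_eq s s' _; [exact: leq_trans | exact: anti_leq |].
    by rewrite perm_map // (perm_trans pB) // perm_sym.
  by apply: (inj_in_map (A := mem (all_letters k)) _ _ _ ew);
    [exact: weight_inj | | ]; rewrite inE; apply/allP => l; rewrite (perm_mem pB, perm_mem pB').
split.
  apply: (@eq_from_nth _ k); first by rewrite sB.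
  move=> p ps; have := congr1 (fun s => (nth (k, false) s p).1) L.
  by rewrite !nth_letters // sB' -sB.
by apply/setP => x; rewrite (mem_coarsen_cut sB bB cM dM) (mem_coarsen_cut sB' bB' cM' dM') e L.
Qed.

(** Take the largest [k] with an interval of length zero, sort all letters by weight and cut where
    the level jumps. *)
Lemma coarsen_onto (c : config) : c \in surj_config n m.+1 ->
  exists k (B : seq 'I_n) (M : {set 'I_(2 * n - 2)}),
  [/\ size B = 2 * n - 1, is_bipermutation_at k B, #|M| = m,
      [set x : 'I_(2 * n - 2) | descent k B x] \subset M & coarsen B M = c].
Proof.
rewrite inE => /andP[/andP[/forallP cle /existsP[i0 ci0]] /eqP csurj].
have [k /eqP ck kmax] :=
  @arg_maxnP _ i0 (fun i => (c i).1 == (c i).2) (fun i : 'I_n => i : nat) ci0.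
have n0 : 0 < n by have := ltn_ord k; lia.
pose w := weight k c; pose l := sort (relpre w leq) (all_letters k).
have pl : perm_eq l (all_letters k) by rewrite perm_sort.
have ul : uniq l by rewrite (perm_uniq pl) uniq_all_letters.
have sl : size l = 2 * n - 1 by rewrite (perm_size pl) size_all_letters.
have sorted_l : sorted (relpre w leq) l by apply: sort_sorted => x y; apply: leq_total.
pose l_ p := nth (k, false) l p; pose B := map fst l.
have sB : size B = 2 * n - 1 by rewrite size_map.
have w_mono p q : p <= q -> q < 2 * n - 1 -> w (l_ p) <= w (l_ q).
  move=> pq qs; have /= := sorted_leq_nth (leT := relpre w leq)
    (fun y x z => @leq_trans (w y) _ _) (fun x => leqnn _) (k, false) sorted_l.
  by apply; rewrite // inE sl // (leq_ltn_trans pq).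
have l_all p : p < 2 * n - 1 -> l_ p \in all_letters k.
  by move=> ps; rewrite -(perm_mem pl) mem_nth ?sl.
have nthB p : p < 2 * n - 1 -> nth k B p = (l_ p).1.
  by move=> ps; rewrite (nth_map (k, false)) ?sl.
have bip : is_bipermutation_at k B.
  have cnt i : count_mem i B = (i != k).+1.
    by rewrite count_map -count_all_letters; apply/permP.
  by apply/andP; split; [rewrite cnt eqxx | apply/forallP => i; rewrite cnt; case: (i != k)].
(* If the levels tie, maximality gives [i < k], and the keys are [i < 2n - i]. *)
have before i : i != k -> w (i, false) < w (i, true).
  move=> ik; rewrite /w /weight /level /=; have := cle i; rewrite leq_eqVlt => /orP[e|lt].
    rewrite (eqP e) ltn_add2l /key /= (negbTE ik).
    have := kmax i e; have := ltn_ord k; have : (i : nat) != k := ik; case: ifP; lia.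
  have := key_lt k (i, false); move: (key _ _) (key _ _) (4 * n) => a b N.
  have := leq_mul2r N (c i).1.+1 (c i).2; rewrite lt orbT mulSn; lia.
have lpos p q i : p < 2 * n - 1 -> q < 2 * n - 1 -> l_ p = (i, false) -> l_ q = (i, true) -> p < q.
  move=> ps qs lp lq; rewrite ltnNge; apply/negP => qp; have := w_mono _ _ qp ps.
  rewrite lp lq leqNgt before //; have := l_all _ qs; by rewrite lq mem_all_letters.
(* Forgetting the bars loses nothing: by [lpos] the unbarred copy of a letter precedes the barred
   one. *)
have lB : letters k B = l.
  apply: (@eq_from_nth _ (k, false)); first by rewrite size_letters sB sl.
  move=> p; rewrite size_letters sB => ps; rewrite nth_letters ?sB // /barred nthB //.
  rewrite -/(l_ p); have [i [b lp]] : exists i b, l_ p = (i, b) by case: (l_ p) => i b; exists i, b.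
  rewrite lp /=; congr (_, _).
  have l_inj q : q < 2 * n - 1 -> l_ q = l_ p -> q = p.
    by move=> qs /eqP; rewrite nth_uniq ?sl // => /eqP.
  case: b lp => lp; last first.
    apply/negP => /(nthP k)[q]; rewrite size_takel ?sB ?(ltnW ps) // => qp.
    have qs := ltn_trans qp ps; rewrite nth_take // nthB // => lq1.
    case lq : (l_ q) lq1 => [i' []] /= ii; rewrite ii in lq.
      by have := lpos _ _ _ ps qs lp lq; lia.
    by have := l_inj _ qs; rewrite lq lp => /(_ erefl); lia.
  have : (i, false) \in l by rewrite (perm_mem pl) mem_all_letters.
  move=> /(nthP (k, false))[q]; rewrite sl => qs lq.
  have qp := lpos _ _ _ qs ps lq lp.
  have -> : i = nth k (take p B) q by rewrite nth_take // nthB // /l_ lq.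
  by rewrite mem_nth // size_takel // sB ltnW.
pose v p := level c (l_ p).
pose M := [set x : 'I_(2 * n - 2) | v x != v x.+1].
have v_mono p : p < 2 * n - 2 -> v p <= v p.+1.
  by move=> pD; apply: (@weight_level k); apply: w_mono; lia.
have v_le p : p <= 2 * n - 2 -> v p <= m.
  by move=> _; rewrite /v /level; case: ifP => _; rewrite -ltnS.
have v_surj j : j <= m -> exists2 p, p <= 2 * n - 2 & v p = j.
  move=> jm; have : (inord j : 'I_m.+1) \in endpoints c by rewrite csurj inE.
  rewrite inE => /existsP[i /orP hi].
  have [x xl <-] : exists2 x, x \in all_letters k & level c x = j.
    case: hi => /eqP hi.
      by exists (i, false); rewrite ?mem_all_letters // /level /= -hi inordK.
    have [ik|ik] := eqVneq i k.
      by exists (i, false); rewrite ?mem_all_letters // /level /= ik ck -ik -hi inordK.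
    by exists (i, true); rewrite ?mem_all_letters ?ik // /level /= -hi inordK.
  move: xl; rewrite -(perm_mem pl) => /(nthP (k, false))[p]; rewrite sl => ps e.
  by exists p; [lia | rewrite /v /l_ e].
have bM p : p <= 2 * n - 2 -> block M p = v p by apply: (block_jumps v_mono v_le v_surj).
have cM : #|M| = m.
  rewrite -block_max bM //; apply/eqP; rewrite eqn_leq v_le //=.
  have [p pD <-] := v_surj m (leqnn m).
  by apply: (@weight_level k); apply: w_mono; lia.
exists k, B, M; split=> //.
(* Without a jump of the level, sortedness by weight is sortedness by [key], which excludes a
   descent. *)
- apply/subsetP => x; rewrite !inE; have xD := ltn_ord x.
  rewrite descent_key ?lB //; last by rewrite sB; lia.
  have x1 : x.+1 < 2 * n - 1 by lia.
  rewrite -!/(l_ _) => h; apply/eqP => e; have := w_mono _ _ (leqnSn x) x1.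
  by rewrite /w /weight -!/(v _) e leq_add2l leqNgt h.
have lv x : x \in all_letters k -> block M (position B x) = level c x.
  move=> xl; have [pD e] := letter_positionE sB bip xl.
  by rewrite bM; [rewrite /v /l_ -lB e | move: pD; rewrite sB; lia].
have inordM p : (inord (block M p) : 'I_m.+1) = block M p :> nat.
  by rewrite inordK // ltnS -cM block_le.
apply/ffunP => i; rewrite ffunE [RHS]surjective_pairing; congr (_, _); apply: val_inj.
  by rewrite /= inordM; apply: (lv (i, false)); rewrite mem_all_letters.
rewrite /= inordM; have [->|ik] := eqVneq i k.
  by rewrite (last_index_special sB bip) -ck; apply: (lv (k, false)); rewrite mem_all_letters.
by apply: (lv (i, true)); rewrite mem_all_letters ik.
Qed.

Definition cut_words : {set word n * {set 'I_(2 * n - 2)}} :=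
  [set x : word n * {set 'I_(2 * n - 2)} | (#|x.2| == m) && [exists k, is_bipermutation_at k x.1 &&
     ([set p : 'I_(2 * n - 2) | descent k x.1 p] \subset x.2)]].

Lemma card_cut_words : #|cut_words| = #|surj_config n m.+1|.
Proof.
rewrite -(card_in_imset (f := fun x : word n * {set 'I_(2 * n - 2)} => coarsen x.1 x.2)).
  apply: eq_card => c; apply/imsetP/idP => [[[B M]]|/coarsen_onto[k [B [M [sB bB cM dM <-]]]]].
    rewrite inE => /andP[/eqP cM /existsP[k /andP[bB dM]]] ->.
    exact: coarsen_surj_config (size_tuple B) bB cM.
  have sB' : size B == 2 * n - 1 by apply/eqP.
  exists (Tuple sB', M) => //; rewrite inE /= cM eqxx /=.
  by apply/existsP; exists k; rewrite bB dM.
move=> [B M] [B' M']; rewrite !inE /= => /andP[/eqP cM /existsP[k /andP[bB dM]]].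
move=> /andP[/eqP cM' /existsP[k' /andP[bB' dM']]] e.
have [BB' ->] := coarsen_inj (size_tuple B) bB cM dM (size_tuple B') bB' cM' dM' e.
by congr (_, _); apply: val_inj.
Qed.

End Coarsening.

(** * Counting cut words by descents *)

Section CountWords.
Local Open Scope nat_scope.

Lemma is_bipermutation_at_uniq n (k k' : 'I_n) B :
  is_bipermutation_at k B -> is_bipermutation_at k' B -> k = k'.
Proof.
move=> /andP[/eqP ck _] /andP[_ /forallP h]; apply/eqP; apply/negPn/negP => ne.
by have := h k; rewrite ne ck.
Qed.

Lemma num_descentsE n (k : 'I_n) (B : word n) :
  num_descents k B = #|[set p : 'I_(2 * n - 2) | descent k B p]|.
Proof.
rewrite /num_descents size_tuple -sum1_card.
have -> : iota 0 (2 * n - 1).-1 = index_iota 0 (2 * n - 2).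
  by rewrite /index_iota; congr iota; lia.
by rewrite -sum1_count big_mkord; apply: eq_bigl => p; rewrite inE.
Qed.

(** For a word with [d] descents, the complements of the admissible cut sets are the subsets of size
    [D - m] of the [D - d] non-descents, where [D = 2 * n - 2]. *)
Lemma card_surj_config n m : 0 < n -> m <= 2 * n - 2 -> #|surj_config n m.+1| =
  \sum_(d < (2 * n - 2).+1) biEulerian_number n d * 'C(2 * n - 2 - d, 2 * n - 2 - m).
Proof.
move=> n0 mD; rewrite -card_cut_words -sum1_card.
have k0 : 'I_n := Ordinal n0.
(* The default [k0] is taken only when [B] is not a bipermutation. *)
pose special (B : word n) := odflt k0 [pick k | is_bipermutation_at k B].
have specialE k (B : word n) : is_bipermutation_at k B -> special B = k.
  rewrite /special => bB; case: pickP => [k' bB'|/(_ k)]; last by rewrite bB.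
  exact: is_bipermutation_at_uniq bB' bB.
pose des (B : word n) := [set p : 'I_(2 * n - 2) | descent (special B) B p].
have des_le B : #|des B| < (2 * n - 2).+1 by rewrite ltnS -[X in _ <= X]card_ord max_card.
rewrite (eq_bigl (fun x : word n * {set 'I_(2 * n - 2)} =>
  bipermutation x.1 && ((#|x.2| == m) && (des x.1 \subset x.2)))); last first.
  move=> [B M]; rewrite inE /= andbCA; congr andb; apply/existsP/andP.
    case=> k /andP[bB dM]; split; first by apply/existsP; exists k.
    by rewrite /des (specialE k).
  case=> /existsP[k bB]; rewrite /des (specialE k) // => dM.
  by exists k; rewrite bB.
rewrite -(pair_big_dep (@bipermutation n)
  (fun B (M : {set 'I_(2 * n - 2)}) => (#|M| == m) && (des B \subset M)) (fun _ _ => 1)) /=.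
have card_super (A : {set 'I_(2 * n - 2)}) :
    \sum_(M : {set 'I_(2 * n - 2)} | (#|M| == m) && (A \subset M)) 1
      = 'C(2 * n - 2 - #|A|, 2 * n - 2 - m).
  have <- : #|~: A| = 2 * n - 2 - #|A| by rewrite cardsCs setCK card_ord.
  rewrite -cards_draws sum1_card -(card_imset _ (inv_inj (@setCK _))).
  apply: eq_card => M; rewrite !inE; apply/imsetP/idP => [[M' /andP[/eqP cM' AM'] ->]|].
    by rewrite setCS AM' cardsCs setCK card_ord cM' eqxx.
  move=> /andP[MA /eqP cM]; exists (~: M); rewrite ?setCK // unfold_in /=.
  by rewrite cardsCs setCK card_ord cM subKn // eqxx -setCS setCK.
under eq_bigr do rewrite card_super.
rewrite (partition_big (fun B => Ordinal (des_le B)) predT) //=; apply: eq_bigr => d _.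
rewrite (eq_bigr (fun _ => 'C(2 * n - 2 - d, 2 * n - 2 - m))); last first.
  by move=> B /andP[_ /eqP <-].
rewrite sum_nat_const; congr (_ * _); apply: eq_card => B; rewrite !inE.
apply/andP/existsP => [[/existsP[k bB] /eqP <-]|[k /andP[bB /eqP e]]].
  by exists k; rewrite bB num_descentsE /= /des (specialE k).
split; first by apply/existsP; exists k.
by rewrite -val_eqE /= -e num_descentsE /des (specialE k).
Qed.

End CountWords.

(** * Cones of configurations *)

From mathcomp Require Import finmap boolp classical_sets functions cardinality.

Section ConfigCones.
Variables (R : realType) (n : nat).
Implicit Types (a b : 'I_n -> nat) (X : nat -> R).

Lemma nondecreasing_homo X : (forall p, X p <= X p.+1) ->
  {homo X : p q / (p <= q)%N >-> p <= q}.
Proof. by apply: homo_leq; [exact: lexx | exact: le_trans]. Qed.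

(** With the minus sign, step functions [X] give the rays of the fan: modulo the all-ones vector,
    minus the indicator of [j < a i] is the indicator of [a i <= j]. *)
Definition config_point a b X : NNspace R n :=
  (vquot_pi _ (\row_i - X (a i)), vquot_pi _ (\row_i X (b i))).

Definition config_cone a b : set (NNspace R n) :=
  [set x | exists X, (forall p, X p <= X p.+1) /\ x = config_point a b X]%classic.

(** The two factors are quotiented separately, so the translations [s] and [t] are independent. *)
Lemma config_point_eq a b a' b' X X' :
  config_point a b X = config_point a' b' X' <->
  exists s t, (forall i, X (a i) = X' (a' i) + s) /\ (forall i, X (b i) = X' (b' i) + t).
Proof.
have line (u v : 'rV[R]_n) : vquot_pi <[const_mx 1 : 'rV[R]_n]>%VS u = vquot_pi _ v <->
    exists s, forall i, u 0 i = v 0 i + s.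
  split=> [/vquot_piP/vlineP[s /rowP e]|[s e]].
    exists s => i; have := e i; rewrite !mxE mulr1 => <-. ring.
  apply/vquot_piP/vlineP; exists s; apply/rowP => i.
  by rewrite !mxE e mulr1 addrC addKr.
split=> [[/line[s e1] /line[t e2]]|[s [t [e1 e2]]]].
  exists (- s), t; split=> i; last by have := e2 i; rewrite !mxE.
  by have := e1 i; rewrite !mxE => /(canRL (@opprK _)); rewrite opprD opprK.
congr (_, _); apply/line; [exists (- s) | exists t] => i; rewrite !mxE ?e1 ?e2 //.
by rewrite opprD.
Qed.

Definition ray a b j : NNspace R n := config_point a b (fun p => (j < p)%:R).

Definition ramp m (c : 'I_m -> R) p := \sum_(j < m) c j * (j < p)%:R.

Lemma rampS m (c : 'I_m -> R) (j : 'I_m) : ramp c j.+1 - ramp c j = c j.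
Proof.
rewrite /ramp -sumrB (bigD1 j) //= ltnS leqnn ltnn mulr1 mulr0 subr0 big1 ?addr0 // => i.
rewrite -val_eqE /= ltnS leq_eqVlt => /negbTE -> /=; exact: subrr.
Qed.

Lemma rampE m X p : (p <= m)%N -> X p = X 0 + ramp (fun j : 'I_m => X j.+1 - X j) p.
Proof.
move=> pm; rewrite /ramp; under eq_bigr do rewrite mulrC mulr_natl mulrb.
rewrite -big_mkcond /= -(big_ord_widen _ (fun j => X j.+1 - X j)) //.
by rewrite -(big_mkord xpredT (fun j => X j.+1 - X j)) telescope_sumr // addrC subrK.
Qed.

Lemma sum_ray a b m (c : 'I_m -> R) :
  \sum_j c j *: ray a b j = config_point a b (ramp c).
Proof.
have E1 : \sum_j c j *: ray a b j =
    (\sum_j c j *: (ray a b j).1, \sum_j c j *: (ray a b j).2).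
  by elim/big_rec3: _ => // i x y z _ ->.
rewrite E1 /ray /config_point /=; congr (_, _);
  rewrite (eq_bigr _ (fun j _ => esym (linearZ _ _))) -linear_sum /=.
  congr (vquot_pi _ _); apply/rowP => i; rewrite summxE !mxE -sumrN.
  by apply: eq_bigr => j _; rewrite !mxE mulrN.
by congr (vquot_pi _ _); apply/rowP => i; rewrite summxE !mxE; apply: eq_bigr => j _; rewrite !mxE.
Qed.

Section OneConfig.
Variables (m : nat) (a b : 'I_n -> nat).
Hypothesis cab : is_config m a b.

Lemma config_pointE X :
  config_point a b X = \sum_(j < m) (X j.+1 - X j) *: ray a b j.
Proof.
case: cab => ab bm _ _; rewrite sum_ray; apply/config_point_eq.
exists (X 0), (X 0); split=> i; rewrite addrC -rampE ?bm //.
exact: leq_trans (bm i).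
Qed.

Definition rays_config := [tuple ray a b j | j < m].

(** In a relation, the interval of length zero forces equal translations in both factors; since
    every position is an endpoint, [ramp c] is constant and its increments [c] vanish. *)
Lemma free_rays_config : free rays_config.
Proof.
case: cab => ab bm [k ek] surj; apply/freeP => c.
rewrite (eq_bigr (fun j => c j *: ray a b j)); last first.
  by move=> j _; rewrite -tnth_nth tnth_mktuple.
rewrite sum_ray => e j.
have : config_point a b (ramp c) = config_point a b (fun=> 0).
  by rewrite e config_pointE big1 // => i _; rewrite subrr scale0r.
case/config_point_eq => s [t [es et]].
have st : s = t by have := et k; rewrite -ek es !add0r.
have E p : (p <= m)%N -> ramp c p = t.
  by move=> /surj[i [<-|<-]]; rewrite ?es ?et add0r ?st.
by rewrite -(rampS c j) !E ?subrr // ltnW.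
Qed.

Lemma cone_rays_config : cone [seq ray a b j | j <- iota 0 m] = config_cone a b.
Proof.
apply/seteqP; split=> x /=.
  case=> c [c0 ->].
  have sz : size [seq ray a b j | j <- iota 0 m] = m by rewrite size_map size_iota.
  pose c' (j : 'I_m) := c (cast_ord (esym sz) j).
  exists (ramp c'); split.
    move=> p; apply: ler_sum => j _; rewrite ler_wpM2l ?c0 // ler_nat.
    by case: (ltnP j p) => [jp|] //; rewrite (leqW jp).
  rewrite -sum_ray (reindex (cast_ord sz)) /=; last first.
    by exists (cast_ord (esym sz)) => j _; rewrite ?cast_ordK ?cast_ordKV.
  apply: eq_bigr => j _; rewrite /c' cast_ordK; congr (_ *: _).
  by rewrite (nth_map 0%N) ?nth_iota ?size_iota //= -[X in (_ < X)%N]sz.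
case=> X [Xm ->].
have sz : size [seq ray a b j | j <- iota 0 m] = m by rewrite size_map size_iota.
exists (fun j => X j.+1 - X j); split=> [j|]; first by rewrite subr_ge0.
rewrite config_pointE (reindex (cast_ord sz)) /=; last first.
  by exists (cast_ord (esym sz)) => j _; rewrite ?cast_ordK ?cast_ordKV.
apply: eq_bigr => j _; congr (_ *: _).
by rewrite (nth_map 0%N) ?nth_iota ?size_iota //= -[X in (_ < X)%N]sz.
Qed.

Lemma ray_in_config_cone (j : nat) : config_cone a b (ray a b j).
Proof.
exists (fun p => (j < p)%:R); split=> // p; rewrite ler_nat.
by case: (ltnP j p) => [jp|] //; rewrite (leqW jp).
Qed.

Lemma ray_in_rays (j : 'I_m) : ray a b j \in rays_config.
Proof. by rewrite -(tnth_mktuple (fun j : 'I_m => ray a b j) j) mem_tnth. Qed.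

Lemma rays_configP x : x \in rays_config -> exists j, x = ray a b j.
Proof. by case/tnthP => j ->; exists j; rewrite tnth_mktuple. Qed.

Lemma config_cone_dim d : cone_dim (config_cone a b : set (NNspace R n)) d <-> d = m.
Proof.
have dimR : \dim <<rays_config>> = m.
  by have /eqP -> := free_rays_config; rewrite size_tuple.
have span : linear_span (config_cone a b : set (NNspace R n)) <<rays_config>>%VS.
  split=> [_ [X [_ ->]]|W WC].
    rewrite config_pointE; apply: rpred_sum => j _; apply: rpredZ.
    exact/memv_span/ray_in_rays.
  apply/span_subvP => _ /rays_configP[j ->]; exact/WC/ray_in_config_cone.
split=> [[U [[CU Umin] <-]]|->]; last by exists <<rays_config>>%VS.
have -> // : U = <<rays_config>>%VS.
apply/eqP; rewrite eqEsubv (Umin _ span.1); exact: span.2 CU.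
Qed.

(** A function [X] that moves only at the cuts in [M] factors through [block M]. *)
Lemma subface_config_cone (M : {set 'I_m}) :
  [set x | exists X, [/\ forall p, X p <= X p.+1, forall j : 'I_m, j \notin M -> X j.+1 = X j
    & x = config_point a b X]]%classic =
  (config_cone (fun i => block M (a i)) (fun i => block M (b i)) : set (NNspace R n)).
Proof.
case: cab => ab bm _ _; apply/seteqP; split=> x [X []].
  (* [g s] is the first position of block [s]; the value [m] returned by a failing [find] is right
     when position [m] forms a block alone. *)
  move=> Xm XM ->; pose g s := find (fun p => s <= block M p)%N (iota 0 m).
  have gm s : (g s <= m)%N by rewrite -[X in (_ <= X)%N](size_iota 0 m) find_size.
  have hasP s p : (s <= block M p)%N -> (p < m)%N -> (g s <= p)%N.
    move=> sp pm; rewrite leqNgt; apply/negP => /(before_find 0%N).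
    by rewrite nth_iota // add0n sp.
  have Xconst q p : (q <= p)%N -> (p <= m)%N -> block M q = block M p -> X q = X p.
    elim: p => [|p IH]; first by rewrite leqn0 => /eqP->.
    rewrite leq_eqVlt => /orP[/eqP->//|]; rewrite ltnS => qp pm e.
    have b1 := block_mono M qp; have b2 := block_mono M (leqnSn p).
    rewrite (IH qp (ltnW pm)); last by lia.
    have := blockS M (Ordinal pm); case: (boolP (_ \in M)) => /= [_|/XM/= -> //]; lia.
  have Xg p : (p <= m)%N -> X (g (block M p)) = X p.
    move=> pm; have gp : (g (block M p) <= p)%N.
      by have [->|ne] := eqVneq p m; [exact: gm | apply: hasP => //; lia].
    apply: Xconst => //; apply/eqP; rewrite eqn_leq block_mono //=.
    have [gmm|] := leqP m (g (block M p)); first by apply: block_mono; lia.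
    rewrite -[X in (_ < X)%N](size_iota 0 m) -has_find => h.
    have := nth_find 0%N h; rewrite nth_iota //.
    by rewrite -[X in (_ < X)%N](size_iota 0 m) -has_find.
  exists (X \o g); split=> [s|].
    have Xle := nondecreasing_homo Xm.
    apply: Xle; rewrite /g; apply: sub_find => p; exact: ltnW.
  apply/config_point_eq; exists 0, 0; split=> i; rewrite addr0 /= Xg ?bm //.
  exact: leq_trans (bm i).
move=> Xm ->; exists (X \o block M); split=> // [p|j jM] /=.
  have Xle := nondecreasing_homo Xm.
  exact/Xle/block_mono.
by rewrite blockS (negbTE jM).
Qed.

(** The cone is simplicial, so a face is determined by the rays on which its functional vanishes. *)
Lemma face_config_cone F : face F (config_cone a b : set (NNspace R n)) <->
  exists M : {set 'I_m}, F = config_cone (fun i => block M (a i)) (fun i => block M (b i)).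
Proof.
have uE (u : 'Hom(NNspace R n, R^o)) X :
    u (config_point a b X) = \sum_(j < m) (X j.+1 - X j) * u (ray a b j).
  by rewrite config_pointE linear_sum; apply: eq_bigr => j _; rewrite linearZ.
split=> [[u [u0 ->]]|[M ->]]; last first.
  (* Adding the dual coordinates outside [M] gives a functional that vanishes exactly on the rays in
     [M]. *)
  pose u : 'Hom(NNspace R n, R^o) :=
    \sum_(j | j \notin M) linfun (coord rays_config j : NNspace R n -> R^o).
  have ur (j : 'I_m) : u (ray a b j) = (j \notin M)%:R.
    rewrite sum_lfunE (eq_bigr (fun i => (j == i)%:R)); last first.
      move=> i _; rewrite lfunE /= -(coord_free j i free_rays_config).
      by rewrite -tnth_nth tnth_mktuple.
    rewrite big_mkcond (bigD1 j) //= eqxx big1 ?addr0; first by case: ifP.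
    by move=> i /negbTE ij; rewrite eq_sym ij; case: ifP.
  have u0 x : config_cone a b x -> 0 <= u x.
    case=> X [Xm ->]; rewrite uE; apply: sumr_ge0 => j _.
    by rewrite mulr_ge0 ?subr_ge0 // ur ler0n.
  exists u; split=> //; rewrite -subface_config_cone; apply/seteqP; split=> x /=.
    case=> X [Xm XM ->]; split; first by exists X.
    rewrite uE big1 // => j _; rewrite ur; case: (boolP (j \in M)) => [_|/XM ->].
      by rewrite mulr0.
    by rewrite subrr mul0r.
  case=> -[X [Xm ->]]; rewrite uE => /eqP.
  rewrite psumr_eq0 => [/allP h|j _]; last by rewrite mulr_ge0 ?subr_ge0 // ur ler0n.
  exists X; split=> // j jM; apply/eqP; rewrite -subr_eq0.
  by have := h j (mem_index_enum _); rewrite ur jM mulr1.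
exists [set j : 'I_m | u (ray a b j) == 0]; rewrite -subface_config_cone.
have ur (j : 'I_m) : 0 <= u (ray a b j) by apply/u0/ray_in_config_cone.
apply/seteqP; split=> x /=.
  case=> -[X [Xm ->]]; rewrite uE => /eqP.
  rewrite psumr_eq0 => [/allP h|j _]; last by rewrite mulr_ge0 ?subr_ge0.
  exists X; split=> // j; rewrite inE => jM; apply/eqP; rewrite -subr_eq0.
  by have := h j (mem_index_enum _); rewrite mulf_eq0 (negbTE jM) orbF.
case=> X [Xm XM ->]; split; first by exists X.
rewrite uE big1 // => j _; case: (boolP (j \in [set j : 'I_m | u (ray a b j) == 0])) => [|/XM ->].
  by rewrite inE => /eqP ->; rewrite mulr0.
by rewrite subrr mul0r.
Qed.

End OneConfig.
(** A right inverse of [X] on [{0, ..., m}] is strictly increasing, hence the identity. *)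
Lemma nondecreasing_onto_id m X : (forall p, X p <= X p.+1) ->
  (forall j, (j <= m)%N -> exists2 p, (p <= m)%N & X p = j%:R) ->
  forall p, (p <= m)%N -> X p = p%:R.
Proof.
move=> Xm onto.
have Xle := nondecreasing_homo Xm.
have onto' (j : 'I_m.+1) : exists p : 'I_m.+1, X p == j%:R.
  have [|p pm e] := onto j; first by rewrite -ltnS.
  by exists (Ordinal (pm : (p < m.+1)%N)); rewrite /= e.
pose g j := xchoose (onto' j).
have gE j : X (g j) = j%:R by apply/eqP/(xchooseP (onto' j)).
have gmono : {mono g : i j / (i <= j)%O}.
  apply: le_mono => i j; rewrite !ltEord => ij; rewrite ltnNge; apply/negP => /Xle.
  by rewrite !gE ler_nat leqNgt ij.
have gid : g =1 id.
  by apply: (@Order.mono_unique _ 'I_m.+1 'I_m.+1 g id) => //; exact: le_total.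
by move=> p pm; rewrite -(gE (Ordinal (pm : (p < m.+1)%N))) gid.
Qed.

Lemma config_cone_inj m a b a' b' : is_config m a b -> is_config m a' b' ->
  config_cone a b = config_cone a' b' -> a =1 a' /\ b =1 b'.
Proof.
move=> [ab bm [k ek] surj] [ab' bm' [k' ek'] surj'] e.
(* The point with [X p = p] lies in both cones. The length-zero intervals [k'] and [k] give [s <= t]
   and [t <= s], and then the second representation must also be the identity up to translation. *)
have [X [Xm]] : config_cone a' b' (config_point a b (fun p => p%:R)).
  by rewrite -e; exists (fun p => p%:R); split=> // p; rewrite ler_nat.
case/config_point_eq => s [t [es et]].
have Xle := nondecreasing_homo Xm.
have st : s = t.
  apply/le_anti/andP; split.
    have := es k'; have := et k'; rewrite -ek' => e1 e2.
    have : (a k')%:R <= (b k')%:R :> R by rewrite ler_nat.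
    by rewrite e1 e2 lerD2l.
  have := es k; have := et k; rewrite -ek => -> e1.
  by move: e1 (Xle _ _ (ab' k)); lra.
rewrite -st in et.
have Z p : (p <= m)%N -> X p + s = p%:R.
  apply: (@nondecreasing_onto_id m (fun p => X p + s)) => [q|j jm].
    by rewrite lerD2r.
  have [i [<-|<-]] := surj j jm; [exists (a' i) | exists (b' i)] => //.
  exact: leq_trans (bm' i).
split=> i; apply/eqP; rewrite -(eqr_nat R) ?es ?et Z //.
exact: leq_trans (bm' i).
Qed.

End ConfigCones.

(** * Cones of the bipermutahedral fan *)

Section Fan.
Variables (R : realType) (n : nat).

(** Ray [j] cuts after position [j], that is, after the first [j.+1] letters. The first components
    differ by the all-ones vector. *)
Lemma rays_word (k : 'I_n) (B : word n) : is_bipermutation_at k B -> rays R B =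
  [seq ray R (fun i => index i B) (fun i => last_index i B) j | j <- iota 0 (2 * n - 2)].
Proof.
move=> bB; rewrite /rays (iotaDl 1 0) -map_comp; apply/eq_in_map => j _ /=.
have mB i : i \in val B by apply: (mem_bip bB).
congr (_, _); rewrite ?addr0 ?add0r.
  apply/vquot_piP/vlineP; exists 1; apply/rowP => i.
  by rewrite !mxE inE opprK mulr1 add1n in_take // ltnS; case: leqP; rewrite ?addr0 ?add0r.
congr (vquot_pi _ _); apply/rowP => i.
by rewrite !mxE inE add1n mem_drop_last_index.
Qed.

Definition surj_config_cone m (c : {ffun 'I_n -> 'I_m.+1 * 'I_m.+1}) : set (NNspace R n) :=
  config_cone (fun i => (c i).1) (fun i => (c i).2).

Lemma surj_config_cone_inj m :
  {in surj_config n m.+1 &, injective (@surj_config_cone m)}.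
Proof.
move=> c c' /is_config_surj hc /is_config_surj hc' e.
have [e1 e2] := config_cone_inj hc hc' e; apply/ffunP => i.
rewrite [LHS]surjective_pairing [RHS]surjective_pairing.
by congr (_, _); apply: val_inj; [exact: e1 | exact: e2].
Qed.

Lemma coarsen_cone (k : 'I_n) (B : word n) (M : {set 'I_(2 * n - 2)}) :
  is_bipermutation_at k B -> surj_config_cone (coarsen #|M| B M) =
  config_cone (fun i => block M (index i B)) (fun i => block M (last_index i B)).
Proof.
move=> bB; congr (config_cone _ _); apply/funext => i;
  by have [h1 h2] := coarsenE B (erefl #|M|) i; rewrite ?h1 ?h2.
Qed.

(** Faces of a maximal cone are coarsenings along arbitrary cut sets; [coarsen_onto] shows that
    every configuration occurs. *)
Lemma bipermutahedral_fan_dim m :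
  [set C | @bipermutahedral_fan R n C /\ cone_dim C m]%classic =
  [set surj_config_cone c | c in [set c | c \in surj_config n m.+1]]%classic.
Proof.
apply/seteqP; split=> C /=.
  case=> -[B /existsP[k bB] FC] dC; have sB : size B = (2 * n - 1)%N := size_tuple B.
  have cB := is_config_word sB bB.
  move: FC; rewrite (rays_word bB) (cone_rays_config R cB).
  case/(face_config_cone cB) => M CE; rewrite CE in dC *.
  have em := (config_cone_dim R (is_config_block M cB) _).1 dC; subst m.
  exists (coarsen #|M| B M); last exact: coarsen_cone bB.
  exact: coarsen_surj_config sB bB erefl.
case=> c cs <-; have [k [B [M [sB bB cM _ ec]]]] := coarsen_onto cs.
have sB' : size B == (2 * n - 1)%N by apply/eqP.
split; last exact/(config_cone_dim R ((is_config_surj c).1 cs)).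
exists (Tuple sB'); first by apply/existsP; exists k.
have cB := is_config_word sB bB.
rewrite (@rays_word k) // (cone_rays_config R cB); apply/(face_config_cone cB); exists M.
by subst m; rewrite -ec; apply: (@coarsen_cone k (Tuple sB')).
Qed.

Lemma fan_fvectorE m : fan_fvector R n m = #|surj_config n m.+1|.
Proof.
rewrite /fan_fvector bipermutahedral_fan_dim.
set A := image _ _; pose s := [seq surj_config_cone c | c <- enum (surj_config n m.+1)].
have As : A = [set` s]%classic.
  apply/seteqP; split=> C /=.
    by case=> c cs <-; apply: map_f; rewrite mem_enum.
  by case/mapP => c; rewrite mem_enum => cs ->; exists c.
have fA : finite_set A by rewrite As; exact: finite_seq.
have -> : fset_set A = seq_fset tt s.
  by apply/fsetP => C; rewrite in_fset_set // seq_fsetE As; apply/idP/idP; rewrite inE.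
rewrite size_seq_fset undup_id ?size_map -?cardE //.
rewrite map_inj_in_uniq ?enum_uniq // => c c'; rewrite !mem_enum.
exact: surj_config_cone_inj.
Qed.

End Fan.

(** * Proof of the theorem *)

Section Assembly.
Variable n : nat.
Local Notation D := (2 * n - 2)%N.
Local Notation b := (biEulerian_number n).
Hypothesis n0 : (0 < n)%N.

Lemma surj_config_eq0 j : (D.+1 < j)%N -> #|surj_config n j| = 0%N.
Proof.
case: j => // m mD; apply: eq_card0 => c; apply/negP => /coarsen_onto[k [B [M [_ _ cM _ _]]]].
by have := max_card (mem M); rewrite cM card_ord; lia.
Qed.

Lemma surj_config0 : #|surj_config n 0| = 0%N.
Proof. by apply: eq_card0 => c; case: (c (Ordinal n0)) => -[]. Qed.

(** Substitute [card_surj_config] into [binomial_surj_config], exchange the sums and apply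
    Vandermonde's identity. *)
Lemma biEulerian_number_worpitzky K : ('C(K.+1, 2) ^ n =
  'C(K, 2) ^ n + \sum_(d < D.+1) b d * 'C(K + D - d, D.+1))%N.
Proof.
rewrite binomial_surj_config //; congr (_ + _)%N.
have widen N N' (g : nat -> nat) : (N <= N')%N -> (forall j, (N <= j)%N -> g j = 0%N) ->
    (\sum_(j < N) g j = \sum_(j < N') g j)%N.
  move=> NN' g0; rewrite (big_ord_widen _ _ NN') [RHS](bigID (fun j : 'I__ => (j < N)%N)) /=.
  by rewrite [X in (_ + X)%N]big1 ?addn0 // => j; rewrite -leqNgt => /g0.
(* Extending to [N] terms and cutting back to [D.+2] adds and removes only zero terms. *)
pose N := maxn K.+1 D.+2; pose g j := ('C(K, j) * #|surj_config n j|)%N.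
rewrite (widen _ N g) ?leq_maxl //; last by move=> j Kj; rewrite /g bin_small.
rewrite -(widen D.+2 N g) ?leq_maxr //; last by move=> j Dj; rewrite /g surj_config_eq0 // muln0.
rewrite big_ord_recl /g surj_config0 muln0 add0n.
under eq_bigr => m _.
  rewrite lift0 card_surj_config ?leq_ord // big_distrr /=.
  under eq_bigr do rewrite mulnCA.
  over.
rewrite exchange_big; apply: eq_bigr => d _; rewrite -big_distrr; congr (_ * _)%N.
have dD : (d <= D)%N by exact: leq_ord.
(* The Vandermonde sum has one more term, for [j = 0], where [C(D - d, D.+1)] vanishes. *)
rewrite -addnBA // -binomial.Vandermonde big_ord_recl subn0.
rewrite (@bin_small (D - d) D.+1) ?ltnS ?leq_subr // muln0 add0n.
by apply: eq_bigr => m _; rewrite lift0 subSS.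
Qed.

(** Expanding [(X + 1)^(D - d)] by the binomial theorem reproduces the formula of [card_surj_config]
    for the face numbers. *)
Lemma bipermutahedral_hvectorE (R : realType) :
  bipermutahedral_hvector R n = mkseq (fun d => (b d)%:Z) D.+1.
Proof.
apply/esym/hvectorP; first by rewrite size_mkseq.
transitivity (\sum_(d < D.+1) \sum_(i < D.+1)
    ((b d * 'C(D - d, D - i))%:R *: 'X^(D - i) : {poly int})).
  apply: eq_bigr => d _; rewrite nth_mkseq // addrC exprDn.
  pose F i : {poly int} := (b d)%:Z *: (1 ^+ (D - d - i) * 'X ^+ i *+ 'C(D - d, i)).
  rewrite scaler_sumr (big_ord_widen D.+1 F) ?ltnS ?leq_subr // /F.
  rewrite (reindex_inj rev_ord_inj) big_mkcond; apply: eq_bigr => i _ /=.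
  rewrite subSS expr1n mul1r -scaler_nat scalerA -natz -natrM.
  case: ifP => // /negbT; rewrite -leqNgt => h; by rewrite bin_small // muln0 scale0r.
rewrite exchange_big; apply: eq_bigr => i _; rewrite -scaler_suml.
by rewrite fan_fvectorE card_surj_config ?leq_ord // -natr_sum natz.
Qed.

End Assembly.

Theorem theorem6p3 (R : realType) (n : nat) (hn : (2 <= n)%N) :
  real_rooted R (biEulerian n) /\
  (log_concave (bipermutahedral_hvector R n) /\
   unimodal (bipermutahedral_hvector R n)).
Proof.
case: n hn => // n _; have W := @biEulerian_number_worpitzky n.+1 isT.
rewrite bipermutahedral_hvectorE //.
have ED : (2 * n.+1 - 2 = n.*2)%N by lia.
rewrite ED in W *.
have [_ _ rr] := worpitzky_poly_nonneg_real_rooted W R[i].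
have tlc := worpitzky_coef_log_concave W R[i].
split; last by split; [exact: mkseq_log_concave | exact: mkseq_unimodal].
move=> z; suff -> : map_poly intr (biEulerian n.+1) =
    \sum_(d < n.*2.+1) (biEulerian_number n.+1 d)%:R *: 'X^d :> {poly R[i]} by exact: rr.
have E1 : (2 * n.+1 - 1 = n.*2.+1)%N by lia.
rewrite /biEulerian E1 rmorph_sum; apply: eq_bigr => d _.
by rewrite /= map_polyZ /= map_polyXn.
Qed.
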